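(* Let $\omega\in\mathbb{C}$ with $\operatorname{Im}\omega>0$, let $m\in\mathbb{Z}$, and let $\lambda$ be an eigenvalue of the angular ODE (with these $\omega,m$). If $u$ solves the homogeneous radial ODE $u''+(\omega^2-V)u=0$ (with these $\omega,m,\lambda$) and satisfies the mode boundary conditions, then $u\equiv0$. Equivalently, there is no nontrivial mode solution $\psi=e^{-i\omega t}e^{im\phi}S(\theta)(r^2+a^2)^{-1/2}u(r^*(r))$ of the wave equation on sub-extremal Kerr with $\operatorname{Im}\omega>0$.
   Context: Fix $M>0$ and $a\in\mathbb{R}$ with $|a|<M$. Let $r_\pm:=M\pm\sqrt{M^2-a^2}$ and $\Delta(r):=r^2-2Mr+a^2=(r-r_+)(r-r_-)$. Let $r^*:(r_+,\infty)\to(-\infty,\infty)$ be a fixed increasing bijection with $\frac{dr^*}{dr}=\frac{r^2+a^2}{\Delta}$; functions of $r\in(r_+,\infty)$ are identified with functions of $r^*\in\mathbb{R}$, and a prime $'$ denotes $d/dr^*$. Complex powers $(r-r_\pm)^c$ mean $e^{c\log(r-r_\pm)}$ with the real logarithm. Angular ODE: for $\omega\in\mathbb{C}$, $m\in\mathbb{Z}$, $\lambda\in\mathbb{C}$, $\frac{1}{\sin\theta}\frac{d}{d\theta}\big(\sin\theta\frac{dS}{d\theta}\big)-\big(\frac{m^2}{\sin^2\theta}-a^2\omega^2\cos^2\theta\big)S+\lambda S=0$ on $(0,\pi)$, together with the requirement that $e^{im\phi}S(\theta)$ extends to a smooth function on $\mathbb{S}^2$. A nonzero such $S$ is an angular eigenfunction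 with eigenvalue $\lambda$. Radial ODE: given $\omega,m,\lambda$, set $V:=\frac{4Mram\omega-a^2m^2+\Delta(\lambda+a^2\omega^2)}{(r^2+a^2)^2}+\frac{\Delta}{(r^2+a^2)^4}\big(a^2\Delta+2Mr(r^2-a^2)\big)$ (with $r=r(r^* )$), and consider $u''+(\omega^2-V)u=H$ ($H=0$: homogeneous). Mode boundary conditions for $u$: with $\xi:=\frac{i(am-2Mr_+\omega)}{r_+-r_-}$, (i) $(r-r_+)^{-\xi}u$, as a function of $r$, extends smoothly to $r=r_+$; (ii) there exist constants $C_0,C_1,\dots$ such that for every $N\ge1$, $u=e^{i\omega r^*}\sum_{i=0}^N C_i r^{-i}+O(r^{-N-1})$ as $r\to\infty$. *)

(* Defs.v *)
From Stdlib Require Import Reals.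
Open Scope R_scope.

Record Cx := Cmk { Re : R; Im : R }.

Definition C0 : Cx := Cmk 0 0.
Definition RtoC (x : R) : Cx := Cmk x 0.
Definition Ci : Cx := Cmk 0 1.
Definition Cadd (z w : Cx) : Cx := Cmk (Re z + Re w) (Im z + Im w).
Definition Copp (z : Cx) : Cx := Cmk (- Re z) (- Im z).
Definition Csub (z w : Cx) : Cx := Cadd z (Copp w).
Definition Cmul (z w : Cx) : Cx :=
  Cmk (Re z * Re w - Im z * Im w) (Re z * Im w + Im z * Re w).
Definition Cscale (k : R) (z : Cx) : Cx := Cmk (k * Re z) (k * Im z).
Definition Cexp (z : Cx) : Cx :=
  Cmk (exp (Re z) * cos (Im z)) (exp (Re z) * sin (Im z)).
Definition Cnorm (z : Cx) : R := sqrt (Re z ^ 2 + Im z ^ 2).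

Definition derivC (f : R -> Cx) (x : R) (d : Cx) : Prop :=
  derivable_pt_lim (fun t => Re (f t)) x (Re d) /\
  derivable_pt_lim (fun t => Im (f t)) x (Im d).

Definition smooth1 (f : R -> R) : Prop :=
  exists D : nat -> R -> R, D 0%nat = f /\
    forall n x, derivable_pt_lim (D n) x (D (S n) x).
Definition smooth1C (f : R -> Cx) : Prop :=
  smooth1 (fun t => Re (f t)) /\ smooth1 (fun t => Im (f t)).

Definition continuous3 (f : R -> R -> R -> R) : Prop :=
  forall x y z eps, 0 < eps -> exists delta, 0 < delta /\
    forall x' y' z', Rabs (x' - x) < delta -> Rabs (y' - y) < delta ->
      Rabs (z' - z) < delta -> Rabs (f x' y' z' - f x y z) < eps.

Definition smooth3 (f : R -> R -> R -> R) : Prop :=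
  exists D : nat -> nat -> nat -> R -> R -> R -> R,
    D 0%nat 0%nat 0%nat = f /\
    (forall i j k, continuous3 (D i j k)) /\
    (forall i j k x y z,
       derivable_pt_lim (fun t => D i j k t y z) x (D (S i) j k x y z) /\
       derivable_pt_lim (fun t => D i j k x t z) y (D i (S j) k x y z) /\
       derivable_pt_lim (fun t => D i j k x y t) z (D i j (S k) x y z)).
Definition smooth3C (F : R -> R -> R -> Cx) : Prop :=
  smooth3 (fun x y z => Re (F x y z)) /\ smooth3 (fun x y z => Im (F x y z)).

Definition rplus (M a : R) : R := M + sqrt (M ^ 2 - a ^ 2).
Definition rminus (M a : R) : R := M - sqrt (M ^ 2 - a ^ 2).
Definition DeltaK (M a r : R) : R := r ^ 2 - 2 * M * r + a ^ 2.

(* Angular eigenvalue: there is a nonzero S on (0,pi) solving the angular ODE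
   (1/sin) (sin S')' - (m^2/sin^2 - a^2 w^2 cos^2) S + lambda S = 0
   such that e^{i m phi} S(theta) extends to a smooth function on S^2
   (i.e. is the restriction of a smooth function on R^3). *)
Definition angular_eigenvalue (a : R) (w : Cx) (m : Z) (lam : Cx) : Prop :=
  exists S : R -> Cx,
    (exists th, 0 < th < PI /\ S th <> C0) /\
    exists S1 T1 : R -> Cx,
      (forall th, 0 < th < PI -> derivC S th (S1 th)) /\
      (forall th, 0 < th < PI ->
         derivC (fun t => Cscale (sin t) (S1 t)) th (T1 th)) /\
      (forall th, 0 < th < PI ->
         Cadd (Cadd (Cscale (/ sin th) (T1 th))
                    (Copp (Cmul (Csub (RtoC (IZR m ^ 2 / sin th ^ 2))
                                      (Cscale (a ^ 2 * cos th ^ 2) (Cmul w w)))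
                                (S th))))
              (Cmul lam (S th)) = C0) /\
    exists F : R -> R -> R -> Cx, smooth3C F /\
      forall th ph, 0 < th < PI ->
        F (sin th * cos ph) (sin th * sin ph) (cos th)
        = Cmul (Cexp (Cscale (IZR m * ph) Ci)) (S th).

Definition Vpot (M a : R) (w : Cx) (m : Z) (lam : Cx) (r : R) : Cx :=
  let D := DeltaK M a r in
  Cadd (Cscale (/ (r ^ 2 + a ^ 2) ^ 2)
          (Cadd (Csub (Cscale (4 * M * r * a * IZR m) w)
                      (RtoC (a ^ 2 * IZR m ^ 2)))
                (Cscale D (Cadd lam (Cscale (a ^ 2) (Cmul w w))))))
       (RtoC (D / (r ^ 2 + a ^ 2) ^ 4 * (a ^ 2 * D + 2 * M * r * (r ^ 2 - a ^ 2)))).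

Definition xi (M a : R) (w : Cx) (m : Z) : Cx :=
  Cscale (/ (rplus M a - rminus M a))
    (Cmul Ci (Csub (RtoC (a * IZR m)) (Cscale (2 * M * rplus M a) w))).

Definition Cpow_real (x : R) (c : Cx) : Cx := Cexp (Cscale (ln x) c).

Fixpoint Csum (f : nat -> Cx) (N : nat) : Cx :=
  match N with
  | O => f O
  | S n => Cadd (Csum f n) (f (S n))
  end.

(* Main.v *)
From Coquelicot Require Import Coquelicot.
From Stdlib Require Import Reals Lra Lia Psatz Factorial.
Require Import Defs.
Open Scope R_scope.

(** Write [p, q] for [r_+, r_-], [d = p - q], [K = (r^2 + a^2) w - a m] and
    [L = lambda + a^2 w^2 - 2 a m w].  The boundary conditions are used only
    to see that [u], hence also [u'], is bounded.  Put
    [g = exp (- i \int K / Delta) (r^2 + a^2)^(-1/2) u]; the radial equation becomes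
    [(Delta g')' + 2 i K g' + (i K' - L) g = 0], with polynomial coefficients,
    so Whiting's transform
    [W (y) = \int exp (2 i w y t / d) g (q + t) dt] satisfies a second order
    equation in [y], again of Kerr type with [y = x - q].  Its potential [Psi] is such that
    [Im (conj w Psi) > 0] for [x > p], because [Im (conj w lambda) <= 0] by the
    angular equation.  Hence the flux [Im (conj w Delta X' conj X)] of the
    suitably weighted transform [X] is monotone; it vanishes at both ends, so
    [W = 0].  All moments of the exponentially decaying function
    [exp (4 i w t) g (q + t)] then vanish, which forces [g = 0]. *)

(** The obstacle is superradiance. For [R = (r^2 + a^2)^(-1/2) u] the radial equation reads
    [(Delta R')' + (K^2 / Delta - L) R = 0], and the flux identity applied to it contains [Im (conj
    w K^2) = Im w ((r^2 + a^2)^2 |w|^2 - (a m)^2)], which is negative near the horizon as soon as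
    [|w|] is small and [a m] is not zero. In [Psi] the number [a m] occurs only linearly and
    multiplied by [w], so that [conj w] makes its contribution real and the imaginary part loses it.
    The square of [a m] is removed by passing to [g], which cancels [K^2 / Delta]. The remaining
    coefficients have degree at most two in [t = r - q], and therefore an exponential kernel
    produces an equation of order two in [y]. The price is that [g] grows like [exp (Im w rs)] at
    infinity. The kernel beats this for [y >= d], where it decays at least like [exp (- 2 Im w t)],
    because the slope of [rs] tends to 1. At the horizon the same factor tends to zero: [g] extends
    continuously by zero and integrations by parts leave no boundary term. *)

(** * Complex derivatives and the norm [|Re| + |Im|] *)

Lemma Cx_eq (z v : Cx) : Re z = Re v -> Im z = Im v -> z = v.
Proof. destruct z, v; simpl; intros -> ->; reflexivity. Qed.

Lemma derivC_eq f x d d' : derivC f x d -> d = d' -> derivC f x d'.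
Proof. intros H <-; exact H. Qed.

Lemma derivC_add f g x df dg :
  derivC f x df -> derivC g x dg ->
  derivC (fun t => Cadd (f t) (g t)) x (Cadd df dg).
Proof.
  intros [F1 F2] [G1 G2]; split; simpl.
  - exact (derivable_pt_lim_plus _ _ _ _ _ F1 G1).
  - exact (derivable_pt_lim_plus _ _ _ _ _ F2 G2).
Qed.

Lemma derivC_opp f x df :
  derivC f x df -> derivC (fun t => Copp (f t)) x (Copp df).
Proof.
  intros [F1 F2]; split; simpl.
  - exact (derivable_pt_lim_opp _ _ _ F1).
  - exact (derivable_pt_lim_opp _ _ _ F2).
Qed.

Lemma derivC_const z x : derivC (fun _ => z) x C0.
Proof. split; simpl; exact (derivable_pt_lim_const _ _). Qed.

Lemma derivC_mul f g x df dg :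
  derivC f x df -> derivC g x dg ->
  derivC (fun t => Cmul (f t) (g t)) x (Cadd (Cmul df (g x)) (Cmul (f x) dg)).
Proof.
  intros [F1 F2] [G1 G2]; split; simpl.
  - replace (Re df * Re (g x) - Im df * Im (g x) + (Re (f x) * Re dg - Im (f x) * Im dg))
      with ((Re df * Re (g x) + Re (f x) * Re dg)
            - (Im df * Im (g x) + Im (f x) * Im dg)) by ring.
    exact (derivable_pt_lim_minus _ _ _ _ _
             (derivable_pt_lim_mult _ _ _ _ _ F1 G1)
             (derivable_pt_lim_mult _ _ _ _ _ F2 G2)).
  - replace (Re df * Im (g x) + Im df * Re (g x) + (Re (f x) * Im dg + Im (f x) * Re dg))
      with ((Re df * Im (g x) + Re (f x) * Im dg)
            + (Im df * Re (g x) + Im (f x) * Re dg)) by ring.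
    exact (derivable_pt_lim_plus _ _ _ _ _
             (derivable_pt_lim_mult _ _ _ _ _ F1 G2)
             (derivable_pt_lim_mult _ _ _ _ _ F2 G1)).
Qed.

Lemma derivC_scale f g x df dg :
  derivable_pt_lim f x df -> derivC g x dg ->
  derivC (fun t => Cscale (f t) (g t)) x (Cadd (Cscale df (g x)) (Cscale (f x) dg)).
Proof.
  intros F [G1 G2]; split; simpl.
  - exact (derivable_pt_lim_mult _ _ _ _ _ F G1).
  - exact (derivable_pt_lim_mult _ _ _ _ _ F G2).
Qed.

Lemma derivC_comp (f : R -> R) (g : R -> Cx) x df dg :
  derivable_pt_lim f x df -> derivC g (f x) dg ->
  derivC (fun t => g (f t)) x (Cscale df dg).
Proof.
  intros F [G1 G2]; split; simpl; rewrite Rmult_comm.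
  - exact (derivable_pt_lim_comp f (fun t => Re (g t)) _ _ _ F G1).
  - exact (derivable_pt_lim_comp f (fun t => Im (g t)) _ _ _ F G2).
Qed.

Lemma derivC_exp f x df :
  derivC f x df -> derivC (fun t => Cexp (f t)) x (Cmul df (Cexp (f x))).
Proof.
  intros [F1 F2].
  apply is_derive_Reals in F1; apply is_derive_Reals in F2.
  split; apply is_derive_Reals; simpl.
  - evar_last.
    + apply (is_derive_mult (fun t => exp (Re (f t))) (fun t => cos (Im (f t)))).
      * apply (is_derive_comp exp (fun t => Re (f t))); [apply is_derive_exp | exact F1].
      * apply (is_derive_comp cos (fun t => Im (f t))); [apply is_derive_cos | exact F2].
      * intros; apply Rmult_comm.
    + unfold scal, mult, plus; simpl; unfold mult; simpl; ring.
  - evar_last.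
    + apply (is_derive_mult (fun t => exp (Re (f t))) (fun t => sin (Im (f t)))).
      * apply (is_derive_comp exp (fun t => Re (f t))); [apply is_derive_exp | exact F1].
      * apply (is_derive_comp sin (fun t => Im (f t))); [apply is_derive_sin | exact F2].
      * intros; apply Rmult_comm.
    + unfold scal, mult, plus; simpl; unfold mult; simpl; ring.
Qed.

(** This norm is submultiplicative and free of square roots, so estimates reduce to linear facts
    about components; the price is the factor 2 in [norm1_exp]. *)
Definition norm1 (z : Cx) : R := Rabs (Re z) + Rabs (Im z).

Lemma norm1_ge0 z : 0 <= norm1 z.
Proof. unfold norm1; pose proof (Rabs_pos (Re z)); pose proof (Rabs_pos (Im z)); lra. Qed.

Lemma Re_le_norm1 z : Rabs (Re z) <= norm1 z.
Proof. unfold norm1; pose proof (Rabs_pos (Im z)); lra. Qed.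

Lemma Im_le_norm1 z : Rabs (Im z) <= norm1 z.
Proof. unfold norm1; pose proof (Rabs_pos (Re z)); lra. Qed.

Lemma norm1_add z v : norm1 (Cadd z v) <= norm1 z + norm1 v.
Proof.
  unfold norm1; simpl.
  pose proof (Rabs_triang (Re z) (Re v)); pose proof (Rabs_triang (Im z) (Im v)); lra.
Qed.

Lemma norm1_opp z : norm1 (Copp z) = norm1 z.
Proof. unfold norm1; simpl; rewrite !Rabs_Ropp; reflexivity. Qed.

Lemma norm1_sub z v : norm1 (Csub z v) <= norm1 z + norm1 v.
Proof. rewrite <- (norm1_opp v); apply norm1_add. Qed.

Lemma norm1_scale x z : norm1 (Cscale x z) = Rabs x * norm1 z.
Proof. unfold norm1; simpl; rewrite !Rabs_mult; ring. Qed.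

Lemma norm1_mul z v : norm1 (Cmul z v) <= norm1 z * norm1 v.
Proof.
  unfold norm1; simpl.
  pose proof (Rabs_triang (Re z * Re v) (- (Im z * Im v))).
  pose proof (Rabs_triang (Re z * Im v) (Im z * Re v)).
  rewrite Rabs_Ropp in *; rewrite !Rabs_mult in *. unfold Rminus; lra.
Qed.

Lemma norm1_mul_le z v A B : norm1 z <= A -> norm1 v <= B -> norm1 (Cmul z v) <= A * B.
Proof.
  intros; eapply Rle_trans; [apply norm1_mul|].
  apply Rmult_le_compat; auto using norm1_ge0.
Qed.

Lemma norm1_RtoC x : norm1 (RtoC x) = Rabs x.
Proof. unfold norm1; simpl; rewrite Rabs_R0; ring. Qed.

Lemma norm1_exp z : norm1 (Cexp z) <= 2 * exp (Re z).
Proof.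
  unfold norm1; simpl. rewrite !Rabs_mult.
  rewrite (Rabs_pos_eq (exp (Re z))) by (left; apply exp_pos).
  assert (Rabs (cos (Im z)) <= 1) by (apply Rabs_le, COS_bound).
  assert (Rabs (sin (Im z)) <= 1) by (apply Rabs_le, SIN_bound).
  pose proof (exp_pos (Re z)). nra.
Qed.

Lemma norm1_le_Cnorm z : norm1 z <= 2 * Cnorm z.
Proof.
  unfold norm1, Cnorm.
  assert (Rabs (Re z) <= sqrt (Re z ^ 2 + Im z ^ 2)).
  { rewrite <- sqrt_Rsqr_abs; apply sqrt_le_1_alt; unfold Rsqr; nra. }
  assert (Rabs (Im z) <= sqrt (Re z ^ 2 + Im z ^ 2)).
  { rewrite <- sqrt_Rsqr_abs; apply sqrt_le_1_alt; unfold Rsqr; nra. }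
  lra.
Qed.

(* Phrased with points rather than limits so that it serves bounded and
   unbounded intervals alike. *)
Lemma nonincreasing_null_ends (I : R -> Prop) (f f' : R -> R) :
  (forall x y z, I x -> I z -> x <= y <= z -> I y) ->
  (forall x, I x -> derivable_pt_lim f x (f' x)) ->
  (forall x, I x -> f' x <= 0) ->
  (forall x eps, I x -> 0 < eps ->
     (exists x1, I x1 /\ x1 < x /\ Rabs (f x1) < eps) /\
     (exists x2, I x2 /\ x < x2 /\ Rabs (f x2) < eps)) ->
  forall x, I x -> f' x = 0.
Proof.
  intros Hc Hd Hneg Hend.
  assert (Hmono : forall x y, I x -> I y -> x < y -> f y <= f x).
  { intros x y Ix Iy Hxy.
    destruct (MVT_cor2 f f' x y Hxy) as (z & Hz & Hz').
    - intros z Hz; apply Hd, (Hc x z y); auto.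
    - assert (f' z <= 0) by (apply Hneg, (Hc x z y); auto; lra). nra. }
  assert (H0 : forall x, I x -> f x = 0).
  { intros x Ix.
    destruct (Rtotal_order (f x) 0) as [H | [H | H]]; auto; exfalso.
    - destruct (Hend x (- f x) Ix) as [_ (x2 & I2 & L2 & B2)]; [lra|].
      pose proof (Hmono x x2 Ix I2 L2). apply Rabs_def2 in B2; lra.
    - destruct (Hend x (f x) Ix) as [(x1 & I1 & L1 & B1) _]; [lra|].
      pose proof (Hmono x1 x I1 Ix L1). apply Rabs_def2 in B1; lra. }
  (* The conclusion concerns [f'] because in the applications it is [f'], a sum of terms of one
     sign, that displays the solution. The points [x1] and [x2] give a neighbourhood of [x] inside
     [I], on which [f] is zero. *)
  intros x Ix.
  destruct (Hend x 1 Ix Rlt_0_1) as [(x1 & I1 & L1 & _) (x2 & I2 & L2 & _)].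
  apply (uniqueness_limite f x); [now apply Hd|].
  apply is_derive_Reals.
  apply (is_derive_ext_loc (fun _ => 0)); [|apply (is_derive_const (V := R_NormedModule))].
  assert (Hp : 0 < Rmin (x - x1) (x2 - x)) by (apply Rmin_pos; lra).
  exists (mkposreal _ Hp); intros y Hy; simpl in Hy.
  unfold ball in Hy; simpl in Hy; unfold AbsRing_ball, abs, minus, plus, opp in Hy; simpl in Hy.
  apply Rabs_def2 in Hy.
  pose proof (Rmin_l (x - x1) (x2 - x)); pose proof (Rmin_r (x - x1) (x2 - x)).
  symmetry; apply H0, (Hc x1 y x2); auto; lra.
Qed.

(** * Integration on the half-line *)

(** Integer endpoints and [real] make the integral a total function, so no convergence proof enters
    the terms; [halfline_int_lim] supplies convergence for exponentially dominated integrands. *)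
Definition halfline_int (f : R -> R) : R :=
  real (Lim_seq (fun n => RInt f 0 (INR n))).

Definition exp_dominated (C k : R) (f : R -> R) : Prop :=
  forall t, 0 <= t -> Rabs (f t) <= C * exp (- k * t).

Lemma RInt_exp C k x y : k <> 0 ->
  is_RInt (fun t => C * exp (- k * t)) x y (C / k * (exp (- k * x) - exp (- k * y))).
Proof.
  intros Hk.
  replace (C / k * (exp (- k * x) - exp (- k * y)))
    with (minus (- C / k * exp (- k * y)) (- C / k * exp (- k * x)))
    by (unfold minus, plus, opp; simpl; field; auto).
  apply (is_RInt_derive (fun t => - C / k * exp (- k * t))).
  - intros t _; auto_derive; [auto | field; auto].
  - intros t _; apply (ex_derive_continuous (V := R_NormedModule)); auto_derive; auto.
Qed.

Lemma ex_RInt_cont (f : R -> R) x y : (forall t, continuous f t) -> ex_RInt f x y.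
Proof. intros Hc; apply (ex_RInt_continuous (V := R_CompleteNormedModule)); auto. Qed.

Lemma RInt_split (f : R -> R) x y z : (forall t, continuous f t) ->
  RInt f x z = (RInt f x y + RInt f y z)%R :> R.
Proof.
  intros Hc; symmetry; apply (RInt_Chasles (V := R_CompleteNormedModule));
    now apply ex_RInt_cont.
Qed.

Lemma RInt_dominated C k (f : R -> R) x y :
  0 < k -> (forall t, continuous f t) -> exp_dominated C k f -> 0 <= x <= y ->
  Rabs (RInt f x y) <= C / k * (exp (- k * x) - exp (- k * y)).
Proof.
  intros Hk Hc Hd Hxy.
  eapply Rle_trans; [apply abs_RInt_le; [lra | now apply ex_RInt_cont]|].
  rewrite <- (is_RInt_unique _ _ _ _ (RInt_exp C k x y (Rgt_not_eq _ _ Hk))).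
  apply RInt_le; [lra | | eexists; apply RInt_exp; lra |].
  - apply ex_RInt_cont; intros t.
    apply (continuous_comp f Rabs); [apply Hc | apply continuous_Rabs].
  - intros t Ht; apply Hd; lra.
Qed.

Lemma exp_dominated_C C k (f : R -> R) : exp_dominated C k f -> 0 <= C.
Proof.
  intros Hd; specialize (Hd 0 (Rle_refl 0)).
  rewrite Rmult_0_r, exp_0 in Hd. pose proof (Rabs_pos (f 0)); lra.
Qed.

Lemma exp_INR_small k eps : 0 < k -> 0 < eps -> exists N, forall n, (N <= n)%nat ->
  exp (- k * INR n) < eps.
Proof.
  intros Hk He.
  destruct (INR_unbounded (/ (k * eps))) as [N HN].
  exists N; intros n Hn.
  assert (Hn' : / (k * eps) < INR n) by (apply le_INR in Hn; lra).
  assert (Hke : 0 < k * eps) by nra.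
  assert (H1 : 1 < k * eps * INR n).
  { apply (Rmult_lt_compat_l (k * eps)) in Hn'; [|lra].
    rewrite Rinv_r in Hn'; lra. }
  assert (H2 : k * INR n < exp (k * INR n)).
  { pose proof (exp_ineq1_le (k * INR n)); lra. }
  replace (- k * INR n) with (- (k * INR n)) by ring.
  rewrite exp_Ropp.
  apply (Rmult_lt_reg_l (exp (k * INR n))); [apply exp_pos|].
  rewrite Rinv_r by (apply Rgt_not_eq, exp_pos). nra.
Qed.

Lemma halfline_int_lim C k (f : R -> R) :
  0 < k -> (forall t, continuous f t) -> exp_dominated C k f ->
  is_lim_seq (fun n => RInt f 0 (INR n)) (halfline_int f).
Proof.
  intros Hk Hc Hd.
  apply Lim_seq_correct', ex_lim_seq_cauchy_corr.
  intros eps.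
  pose proof (exp_dominated_C _ _ _ Hd) as HC.
  (* The tail beyond [n] is at most [C / k * exp (- k n)]; the added 1 keeps the quotient meaningful
     when [C = 0]. *)
  destruct (exp_INR_small k (eps / (C / k + 1)) Hk) as [N HN].
  { apply Rdiv_lt_0_compat; [apply eps|].
    assert (0 <= C / k) by (apply Rdiv_le_0_compat; lra). lra. }
  assert (Hw : forall n m, (N <= n)%nat -> (n <= m)%nat ->
    Rabs (RInt f 0 (INR m) - RInt f 0 (INR n)) < eps).
  { intros n m Hn Hm.
    rewrite (RInt_split f 0 (INR n) (INR m) Hc).
    match goal with |- Rabs (?x + ?y - ?x) < _ => replace (x + y - x) with y by lra end.
    apply le_INR in Hm; pose proof (pos_INR n).
    eapply Rle_lt_trans; [apply (RInt_dominated C k); auto; lra|].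
    specialize (HN n Hn). pose proof (exp_pos (- k * INR m)).
    pose proof (exp_pos (- k * INR n)).
    assert (0 <= C / k) by (apply Rdiv_le_0_compat; lra).
    apply Rmult_lt_compat_r with (r := C / k + 1) in HN; [|lra].
    replace (eps / (C / k + 1) * (C / k + 1)) with (pos eps) in HN by (field; split; lra).
    nra. }
  exists N; intros n m Hn Hm.
  destruct (Nat.le_ge_cases n m) as [H | H].
  - rewrite Rabs_minus_sym; now apply Hw.
  - now apply Hw.
Qed.

Lemma halfline_int_bound C k (f : R -> R) :
  0 < k -> (forall t, continuous f t) -> exp_dominated C k f ->
  Rabs (halfline_int f) <= C / k.
Proof.
  intros Hk Hc Hd.
  pose proof (is_lim_seq_abs _ _ (halfline_int_lim C k f Hk Hc Hd)) as HL; simpl in HL.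
  apply (is_lim_seq_le (fun n => Rabs (RInt f 0 (INR n))) (fun _ => C / k)
           (Rabs (halfline_int f)) (C / k)); auto using is_lim_seq_const.
  intros n; pose proof (pos_INR n).
  eapply Rle_trans; [apply (RInt_dominated C k); auto; lra|].
  rewrite Rmult_0_r, exp_0.
  pose proof (exp_pos (- k * INR n)); pose proof (exp_dominated_C _ _ _ Hd).
  assert (0 <= C / k) by (apply Rdiv_le_0_compat; lra). nra.
Qed.

Lemma halfline_int_unique f (l : R) :
  is_lim_seq (fun n => RInt f 0 (INR n)) l -> halfline_int f = l.
Proof. intros H; unfold halfline_int; now rewrite (is_lim_seq_unique _ _ H). Qed.

Lemma halfline_int_ext f g :
  (forall t, 0 <= t -> f t = g t) -> halfline_int f = halfline_int g.
Proof.
  intros H; unfold halfline_int; f_equal; apply Lim_seq_ext; intros n.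
  apply RInt_ext; intros t Ht.
  rewrite Rmin_left in Ht by apply pos_INR. apply H; lra.
Qed.

Lemma halfline_int_lin C1 k1 C2 k2 (f g : R -> R) x y :
  0 < k1 -> (forall t, continuous f t) -> exp_dominated C1 k1 f ->
  0 < k2 -> (forall t, continuous g t) -> exp_dominated C2 k2 g ->
  halfline_int (fun t => x * f t + y * g t) = x * halfline_int f + y * halfline_int g.
Proof.
  intros Hk1 Hf Df Hk2 Hg Dg.
  apply halfline_int_unique.
  pose proof (halfline_int_lim _ _ _ Hk1 Hf Df) as L1.
  pose proof (halfline_int_lim _ _ _ Hk2 Hg Dg) as L2.
  apply (is_lim_seq_ext (fun n => x * RInt f 0 (INR n) + y * RInt g 0 (INR n))).
  - intros n. symmetry; apply is_RInt_unique.
    apply (is_RInt_plus (V := R_NormedModule));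
      apply (is_RInt_scal (V := R_NormedModule)); apply (RInt_correct (V := R_CompleteNormedModule));
      now apply ex_RInt_cont.
  - apply is_lim_seq_plus'; [exact (is_lim_seq_scal_l _ x _ L1) | exact (is_lim_seq_scal_l _ y _ L2)].
Qed.

(** The fundamental theorem of calculus with both boundary values zero. [B] is differentiable only
    past [d]; its continuity carries the value zero across [d], and domination gives zero at
    infinity. *)
Lemma halfline_int_derivative_zero (f B : R -> R) d C k :
  0 <= d -> 0 < k -> (forall t, continuous f t) ->
  (forall t, t <= d -> f t = 0) -> (forall t, t <= d -> B t = 0) ->
  (forall t, continuous B t) -> exp_dominated C k B ->
  (forall t, d < t -> derivable_pt_lim B t (f t)) ->
  halfline_int f = 0.
Proof.
  intros Hd Hk Hf f0 B0 HB DB Hder.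
  assert (HR : forall t, d <= t -> RInt f 0 t = B t).
  { intros t Ht.
    destruct (MVT_gen (fun x => RInt f 0 x - B x) d t (fun _ => 0)) as (z & _ & Hz).
    - intros x; rewrite Rmin_left, Rmax_right by lra; intros Hx.
      evar_last.
      + apply (is_derive_minus (V := R_NormedModule)).
        * apply (is_derive_RInt f (RInt f 0) 0); [|apply Hf].
          apply filter_forall; intros y.
          apply (RInt_correct (V := R_CompleteNormedModule)), ex_RInt_cont, Hf.
        * apply is_derive_Reals, Hder; lra.
      + unfold minus, plus, opp; simpl; ring.
    - intros x _. apply continuity_pt_filterlim.
      apply (continuous_minus (V := R_NormedModule)); [|apply HB].
      apply (ex_derive_continuous (V := R_NormedModule)).
      eexists; apply (is_derive_RInt f (RInt f 0) 0); [|apply Hf].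
      apply filter_forall; intros y.
      apply (RInt_correct (V := R_CompleteNormedModule)), ex_RInt_cont, Hf.
    - assert (RInt f 0 d = 0).
      { rewrite (RInt_ext f (fun _ => 0)).
        - rewrite RInt_const; unfold scal; simpl; unfold mult; simpl; ring.
        - intros x; rewrite Rmin_left, Rmax_right by lra; intros Hx; apply f0; lra. }
      rewrite (B0 d) in Hz by lra. lra. }
  apply halfline_int_unique.
  apply (is_lim_seq_ext_loc (fun n => B (INR n))).
  { destruct (INR_unbounded d) as [N HN]; exists N; intros n Hn.
    symmetry; apply HR; apply le_INR in Hn; lra. }
  apply is_lim_seq_abs_0.
  apply (is_lim_seq_le_le (fun _ => 0) _ (fun n => C * exp (- k * INR n))).
  - intros n; split; [apply Rabs_pos | apply DB, pos_INR].
  - apply is_lim_seq_const.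
  - replace (Finite 0) with (Rbar_mult C 0) by (simpl; f_equal; ring).
    apply is_lim_seq_scal_l, is_lim_seq_spec.
    intros eps; destruct (exp_INR_small k eps Hk (cond_pos eps)) as [N HN].
    exists N; intros n Hn. rewrite Rminus_0_r, Rabs_pos_eq by (left; apply exp_pos).
    now apply HN.
Qed.

(** One mean value step produces [f1] at an intermediate point, a second one compares it with
    [f1 x]; hence [K * e ^ 2] without the Taylor factor 1/2. [Rmin] and [Rmax] admit increments of
    either sign. *)
Lemma second_order_bound (f f1 f2 : R -> R) x e K :
  (forall y, Rmin x (x + e) <= y <= Rmax x (x + e) -> derivable_pt_lim f y (f1 y)) ->
  (forall y, Rmin x (x + e) <= y <= Rmax x (x + e) -> derivable_pt_lim f1 y (f2 y)) ->
  (forall y, Rmin x (x + e) <= y <= Rmax x (x + e) -> Rabs (f2 y) <= K) ->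
  Rabs (f (x + e) - f x - e * f1 x) <= K * e ^ 2.
Proof.
  intros H1 H2 H3.
  destruct (MVT_gen f x (x + e) f1) as (z & Hz & Ez).
  { intros y Hy; apply is_derive_Reals, H1; lra. }
  { intros y Hy; apply derivable_continuous_pt; eexists; apply H1; exact Hy. }
  assert (Hin : forall y, Rmin x z <= y <= Rmax x z -> Rmin x (x + e) <= y <= Rmax x (x + e)).
  { intros y; unfold Rmin, Rmax in *;
      destruct (Rle_dec x (x + e)); destruct (Rle_dec x z); lra. }
  destruct (MVT_gen f1 x z f2) as (v & Hv & Ev).
  { intros y Hy; apply is_derive_Reals, H2, Hin; lra. }
  { intros y Hy; apply derivable_continuous_pt; eexists; apply H2, Hin; exact Hy. }
  assert (HK := H3 v (Hin v Hv)).
  replace (f (x + e) - f x - e * f1 x) with (e * (f2 v * (z - x))).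
  - rewrite !Rabs_mult.
    assert (Hzx : Rabs (z - x) <= Rabs e).
    { unfold Rmin, Rmax in Hz; destruct (Rle_dec x (x + e)).
      - rewrite !Rabs_pos_eq; lra.
      - rewrite !Rabs_left1; lra. }
    replace (K * e ^ 2) with (Rabs e * (K * Rabs e)).
    + apply Rmult_le_compat_l; [apply Rabs_pos|].
      apply Rmult_le_compat; auto using Rabs_pos.
    + rewrite <- (pow2_abs e); ring.
  - rewrite <- Ev. replace (f (x + e) - f x) with (f1 z * (x + e - x)) by lra. ring.
Qed.

(** A bound on the second derivative in [y], uniform in [y], makes the error of the difference
    quotient at most [C / k * |e|]. This takes the place of dominated convergence. *)
Lemma halfline_int_leibniz (f f1 f2 : R -> R -> R) y0 l C k :
  0 < k -> l < y0 ->
  (forall y t, l < y -> 0 <= t -> derivable_pt_lim (fun y => f y t) y (f1 y t)) ->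
  (forall y t, l < y -> 0 <= t -> derivable_pt_lim (fun y => f1 y t) y (f2 y t)) ->
  (forall y t, l < y -> continuous (f y) t) ->
  (forall t, continuous (f1 y0) t) ->
  (forall y, l < y -> exp_dominated C k (f y)) ->
  exp_dominated C k (f1 y0) ->
  (forall y, l < y -> exp_dominated C k (f2 y)) ->
  derivable_pt_lim (fun y => halfline_int (f y)) y0 (halfline_int (f1 y0)).
Proof.
  intros Hk Hl D1 D2 Cf Cf1 Ef Ef1 Ef2.
  pose proof (exp_dominated_C _ _ _ Ef1) as HC.
  assert (HCk : 0 <= C / k) by (apply Rdiv_le_0_compat; lra).
  intros eps Heps.
  (* The first entry keeps [y0 + e] to the right of [l], the second makes the error [C / k * |e|]
     smaller than [eps]. *)
  assert (Hdel : 0 < Rmin (y0 - l) (eps / (C / k + 1))).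
  { apply Rmin_pos; [lra | apply Rdiv_lt_0_compat; lra]. }
  exists (mkposreal _ Hdel); intros e He0 He; simpl in He.
  assert (He1 : Rabs e < y0 - l) by (eapply Rlt_le_trans; [exact He | apply Rmin_l]).
  assert (He2 : Rabs e < eps / (C / k + 1)) by (eapply Rlt_le_trans; [exact He | apply Rmin_r]).
  assert (Hye : l < y0 + e) by (apply Rabs_def2 in He1; lra).
  assert (Hin : forall y, Rmin y0 (y0 + e) <= y <= Rmax y0 (y0 + e) -> l < y).
  { intros y Hy; unfold Rmin in Hy; destruct (Rle_dec y0 (y0 + e)); lra. }
  assert (Hlin : halfline_int (fun t => f (y0 + e) t - f y0 t - e * f1 y0 t)
     = halfline_int (f (y0 + e)) - halfline_int (f y0) - e * halfline_int (f1 y0)).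
  { transitivity (halfline_int
      (fun t => 1 * (1 * f (y0 + e) t + (-1) * f y0 t) + (- e) * f1 y0 t)).
    { apply halfline_int_ext; intros; ring. }
    rewrite (halfline_int_lin (2 * C) k C k); auto.
    - rewrite (halfline_int_lin C k C k); auto. ring.
    - intros t; apply (continuous_plus (V := R_NormedModule));
        apply (continuous_scal_r (V := R_NormedModule)); auto.
    - intros t Ht. specialize (Ef (y0 + e) Hye t Ht) as E1; specialize (Ef y0 Hl t Ht) as E2.
      replace (1 * f (y0 + e) t + -1 * f y0 t) with (f (y0 + e) t - f y0 t) by ring.
      pose proof (Rabs_triang (f (y0 + e) t) (- f y0 t)) as E3.
      rewrite Rabs_Ropp in E3. unfold Rminus; lra. }
  assert (Hb : Rabs (halfline_int (fun t => f (y0 + e) t - f y0 t - e * f1 y0 t))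
               <= C * e ^ 2 / k).
  { apply halfline_int_bound; auto.
    - intros t; apply (continuous_minus (V := R_NormedModule)).
      + apply (continuous_minus (V := R_NormedModule)); auto.
      + apply (continuous_scal_r (V := R_NormedModule)); auto.
    - intros t Ht.
      replace (C * e ^ 2 * exp (- k * t)) with ((C * exp (- k * t)) * e ^ 2) by ring.
      apply (second_order_bound (fun y => f y t) (fun y => f1 y t) (fun y => f2 y t));
        intros y Hy; [apply D1 | apply D2 | apply Ef2]; eauto. }
  rewrite Hlin in Hb.
  replace ((halfline_int (f (y0 + e)) - halfline_int (f y0)) / e - halfline_int (f1 y0))
    with ((halfline_int (f (y0 + e)) - halfline_int (f y0) - e * halfline_int (f1 y0)) / e)
    by (field; auto).
  unfold Rdiv at 1; rewrite Rabs_mult, Rabs_inv.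
  assert (Hae : 0 < Rabs e) by now apply Rabs_pos_lt.
  apply (Rmult_lt_reg_r (Rabs e)); [exact Hae|].
  rewrite Rmult_assoc, Rinv_l, Rmult_1_r by lra.
  eapply Rle_lt_trans; [exact Hb|].
  rewrite <- (pow2_abs e).
  replace (C * Rabs e ^ 2 / k) with ((C / k * Rabs e) * Rabs e) by (field; lra).
  apply Rmult_lt_compat_r; [exact Hae|].
  apply (Rmult_lt_compat_l (C / k + 1)) in He2; [|lra].
  replace ((C / k + 1) * (eps / (C / k + 1))) with eps in He2 by (field; split; lra).
  lra.
Qed.

(** * Determinacy of exponentially decaying moment problems *)

Lemma nonneg_of_deriv (f f' : R -> R) :
  0 <= f 0 -> (forall x, derivable_pt_lim f x (f' x)) ->
  (forall x, 0 <= x -> 0 <= f' x) -> forall x, 0 <= x -> 0 <= f x.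
Proof.
  intros H0 Hd Hp x Hx.
  destruct (Req_dec x 0) as [-> | Hn]; [exact H0|].
  destruct (MVT_cor2 f f' 0 x) as (z & Hz & Hz'); [lra | intros; apply Hd |].
  assert (0 <= f' z) by (apply Hp; lra). nra.
Qed.

Lemma derive_pow_fact n x :
  is_derive (fun x => x ^ S n / INR (fact (S n))) x (x ^ n / INR (fact n)).
Proof.
  rewrite fact_simpl, mult_INR.
  pose proof (INR_fact_lt_0 n) as Hf; pose proof (pos_INR n) as Hn.
  assert (HS : INR (S n) = INR n + 1) by apply S_INR.
  set (F := INR (fact n)) in *; set (G := INR (S n)) in *; clearbody F G.
  auto_derive; [exact I|].
  change (match n with 0%nat => 1 | S _ => INR n + 1 end) with (INR (S n)).
  rewrite S_INR, HS. simpl pred. field; lra.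
Qed.

Lemma pow_fact_le_exp n x : 0 <= x -> x ^ n / INR (fact n) <= exp x.
Proof.
  revert x; induction n as [|n IH]; intros x Hx.
  - simpl; pose proof (exp_ineq1_le x); lra.
  - enough (0 <= exp x - x ^ S n / INR (fact (S n))) by lra.
    revert x Hx; apply (nonneg_of_deriv _ (fun x => exp x - x ^ n / INR (fact n))).
    + rewrite exp_0, pow_i by lia. unfold Rdiv; lra.
    + intros x; apply is_derive_Reals.
      apply (is_derive_minus (V := R_NormedModule)); [apply is_derive_exp | apply derive_pow_fact].
    + intros x Hx; specialize (IH x Hx); lra.
Qed.

(** The remainder of [exp (- x)] after [N] Taylor terms. Differentiation lowers [N] by one and
    changes the sign, which yields the bound [x ^ N / N!] by induction. *)
Fixpoint exp_opp_rem (N : nat) (x : R) : R :=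
  match N with
  | O => exp (- x)
  | S n => exp_opp_rem n x - (-1) ^ n * (x ^ n / INR (fact n))
  end.

Lemma exp_opp_rem_deriv N x : is_derive (exp_opp_rem (S N)) x (- exp_opp_rem N x).
Proof.
  induction N as [|N IH].
  - simpl. auto_derive; [exact I | lra].
  - evar_last.
    + apply (is_derive_minus (V := R_NormedModule) (exp_opp_rem (S N))); [exact IH|].
      apply (is_derive_scal (fun x => x ^ S N / INR (fact (S N)))), derive_pow_fact.
    + cbn [exp_opp_rem]; unfold minus, plus, opp, scal; simpl; unfold mult; simpl; ring.
Qed.

Lemma exp_opp_rem_0 N : exp_opp_rem (S N) 0 = 0.
Proof.
  induction N as [|N IH].
  - simpl; rewrite Ropp_0, exp_0; lra.
  - change (exp_opp_rem (S (S N)) 0) with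
      (exp_opp_rem (S N) 0 - (-1) ^ S N * (0 ^ S N / INR (fact (S N)))).
    rewrite IH, (pow_i (S N)) by lia. unfold Rdiv; ring.
Qed.

Lemma exp_opp_rem_bound N x : 0 <= x -> Rabs (exp_opp_rem N x) <= x ^ N / INR (fact N).
Proof.
  revert x; induction N as [|N IH]; intros x Hx.
  - simpl. rewrite Rabs_pos_eq by (left; apply exp_pos).
    rewrite exp_Ropp. unfold Rdiv; rewrite Rinv_1, Rmult_1_r.
    rewrite <- Rinv_1. apply Rinv_le_contravar; [lra|].
    pose proof (exp_ineq1_le x); lra.
  - apply Rabs_le.
    assert (H1 : 0 <= x ^ S N / INR (fact (S N)) - exp_opp_rem (S N) x).
    { revert x Hx; apply (nonneg_of_deriv _ (fun x => x ^ N / INR (fact N) + exp_opp_rem N x)).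
      - rewrite exp_opp_rem_0, pow_i by lia; unfold Rdiv; lra.
      - intros x; apply is_derive_Reals; evar_last.
        + apply (is_derive_minus (V := R_NormedModule));
            [apply derive_pow_fact | apply exp_opp_rem_deriv].
        + unfold minus, plus, opp; simpl; ring.
      - intros x Hx; specialize (IH x Hx); apply Rabs_le_between in IH; lra. }
    assert (H2 : 0 <= x ^ S N / INR (fact (S N)) + exp_opp_rem (S N) x).
    { revert x Hx H1; intros x Hx _; revert x Hx.
      apply (nonneg_of_deriv _ (fun x => x ^ N / INR (fact N) - exp_opp_rem N x)).
      - rewrite exp_opp_rem_0, pow_i by lia; unfold Rdiv; lra.
      - intros x; apply is_derive_Reals; evar_last.
        + apply (is_derive_plus (V := R_NormedModule));
            [apply derive_pow_fact | apply exp_opp_rem_deriv].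
        + unfold minus, plus, opp; simpl; ring.
      - intros x Hx; specialize (IH x Hx); apply Rabs_le_between in IH; lra. }
    lra.
Qed.

Lemma pow_le_exp n k t : 0 < k -> 0 <= t -> t ^ n <= INR (fact n) / k ^ n * exp (k * t).
Proof.
  intros Hk Ht.
  assert (Hkt : 0 <= k * t) by nra.
  pose proof (pow_fact_le_exp n (k * t) Hkt) as H.
  pose proof (INR_fact_lt_0 n); pose proof (pow_lt k n Hk).
  apply (Rmult_le_compat_l (INR (fact n) / k ^ n)) in H;
    [|apply Rlt_le, Rdiv_lt_0_compat; lra].
  eapply Rle_trans; [|exact H]. right. rewrite Rpow_mult_distr. field; lra.
Qed.

(** Half of the rate pays for the power of [t]. *)
Lemma exp_dominated_pow C k (f : R -> R) n : 0 < k -> exp_dominated C k f ->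
  exp_dominated (INR (fact n) / (k / 2) ^ n * C) (k / 2) (fun t => t ^ n * f t).
Proof.
  intros Hk Hd t Ht.
  pose proof (pow_le_exp n (k / 2) t ltac:(lra) Ht) as H1.
  specialize (Hd t Ht).
  rewrite Rabs_mult, (Rabs_pos_eq (t ^ n)) by now apply pow_le.
  replace (- (k / 2) * t) with (k / 2 * t + - k * t) by field.
  rewrite exp_plus.
  replace (INR (fact n) / (k / 2) ^ n * C * (exp (k / 2 * t) * exp (- k * t)))
    with (INR (fact n) / (k / 2) ^ n * exp (k / 2 * t) * (C * exp (- k * t))) by ring.
  apply Rmult_le_compat; auto using Rabs_pos. now apply pow_le.
Qed.

Lemma exp_dominated_shift C k s (f : R -> R) : 0 <= s -> exp_dominated C k f ->
  exp_dominated C k (fun t => exp (- s * t) * f t).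
Proof.
  intros Hs Hd t Ht; rewrite Rabs_mult, (Rabs_pos_eq (exp _)) by (left; apply exp_pos).
  specialize (Hd t Ht). pose proof (Rabs_pos (f t)).
  assert (exp (- s * t) <= 1).
  { rewrite <- exp_0. destruct (Req_dec (- s * t) 0) as [-> | Hn]; [lra|].
    left; apply exp_increasing; nra. }
  pose proof (exp_pos (- s * t)). nra.
Qed.

Ltac cont_elem :=
  apply (ex_derive_continuous (V := R_NormedModule)); auto_derive; auto.

Lemma cont_mult (f g : R -> R) t :
  continuous f t -> continuous g t -> continuous (fun t => f t * g t) t.
Proof. intros; apply (continuous_mult (K := R_AbsRing)); auto. Qed.

Definition null_moments (f : R -> R) : Prop :=
  forall n, halfline_int (fun t => t ^ n * f t) = 0.

Lemma cont_pow_mult n (f : R -> R) t : continuous f t -> continuous (fun t => t ^ n * f t) t.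
Proof. intros; apply cont_mult; auto; cont_elem. Qed.

Lemma cont_exp_mult s (f : R -> R) t :
  continuous f t -> continuous (fun t => exp (- s * t) * f t) t.
Proof. intros; apply cont_mult; auto; cont_elem. Qed.

Lemma continuous_exp_opp_rem N s t : continuous (fun t => exp_opp_rem N (s * t)) t.
Proof.
  apply (continuous_comp (fun t => s * t) (exp_opp_rem N)); [cont_elem|].
  induction N as [|N IH]; simpl; [cont_elem|].
  apply (continuous_minus (V := R_NormedModule)); [exact IH | cont_elem].
Qed.

(* The Taylor remainder of order [N] of [exp (- s t)] loses a factor [2 ^ N]
   against [exp (k t / 2)], so the vanishing moments may be summed. *)
Lemma null_moments_shift_small C k s (f : R -> R) :
  0 < k -> 0 <= s <= k / 4 -> (forall t, continuous f t) -> exp_dominated C k f ->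
  null_moments f -> null_moments (fun t => exp (- s * t) * f t).
Proof.
  intros Hk Hs Hc Hd Hm n.
  pose proof (exp_dominated_C _ _ _ Hd) as HC.
  (* The rate [k] is spent as follows: a quarter absorbs [t ^ n], a half absorbs the Taylor
     remainder, and a quarter remains for convergence. *)
  set (C' := INR (fact n) / (k / 4) ^ n * C).
  assert (Hdom : forall N, exp_dominated (C' * (/ 2) ^ N) (k / 4)
             (fun t => t ^ n * (exp_opp_rem N (s * t) * f t))).
  { intros N t Ht.
    pose proof (pow_le_exp n (k / 4) t ltac:(lra) Ht) as H1.
    assert (H2 : Rabs (exp_opp_rem N (s * t)) <= (/ 2) ^ N * exp (k / 2 * t)).
    { eapply Rle_trans; [apply exp_opp_rem_bound; nra|].
      pose proof (pow_fact_le_exp N (k / 2 * t) ltac:(nra)) as H2.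
      pose proof (INR_fact_lt_0 N).
      assert (H3 : (s * t) ^ N <= (/ 2 * (k / 2 * t)) ^ N) by (apply pow_incr; nra).
      rewrite (Rpow_mult_distr (/ 2)) in H3.
      apply (Rmult_le_compat_l ((/ 2) ^ N)) in H2; [|apply pow_le; lra].
      eapply Rle_trans; [|exact H2].
      unfold Rdiv at 1; unfold Rdiv at 1. rewrite <- Rmult_assoc.
      apply Rmult_le_compat_r; [left; now apply Rinv_0_lt_compat | exact H3]. }
    specialize (Hd t Ht).
    rewrite !Rabs_mult, (Rabs_pos_eq (t ^ n)) by now apply pow_le.
    replace (C' * (/ 2) ^ N * exp (- (k / 4) * t)) with
      (INR (fact n) / (k / 4) ^ n * exp (k / 4 * t)
       * ((/ 2) ^ N * exp (k / 2 * t) * (C * exp (- k * t)))).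
    - apply Rmult_le_compat; auto; [now apply pow_le | |].
      + apply Rmult_le_pos; apply Rabs_pos.
      + apply Rmult_le_compat; auto using Rabs_pos.
    - unfold C'.
      replace (- (k / 4) * t) with (k / 4 * t + (k / 2 * t + - k * t)) by field.
      rewrite !exp_plus. ring. }
  assert (Hcont : forall N t, continuous (fun t => t ^ n * (exp_opp_rem N (s * t) * f t)) t).
  { intros N t; apply cont_pow_mult, cont_mult; auto using continuous_exp_opp_rem. }
  (* Raising [N] subtracts a multiple of the moment of order [n + N], which is zero. So the integral
     does not depend on [N], while [Hdom] bounds it by a multiple of [(/ 2) ^ N]. *)
  assert (Heq : forall N, halfline_int (fun t => t ^ n * (exp_opp_rem N (s * t) * f t))
                          = halfline_int (fun t => t ^ n * (exp (- s * t) * f t))).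
  { induction N as [|N IH].
    - apply halfline_int_ext; intros t _; simpl. now rewrite Ropp_mult_distr_l.
    - rewrite <- IH.
      transitivity (halfline_int (fun t =>
        1 * (t ^ n * (exp_opp_rem N (s * t) * f t))
        + (- ((-1) ^ N * s ^ N / INR (fact N))) * (t ^ (n + N) * f t))).
      + apply halfline_int_ext; intros t _; cbn [exp_opp_rem].
        rewrite pow_add, Rpow_mult_distr. unfold Rdiv; ring.
      + rewrite (halfline_int_lin (C' * (/ 2) ^ N) (k / 4)
                   (INR (fact (n + N)) / (k / 2) ^ (n + N) * C) (k / 2)); auto; try lra.
        * rewrite (Hm (n + N)%nat). ring.
        * intros t; now apply cont_pow_mult.
        * now apply exp_dominated_pow. }
  apply Rabs_eq_0.
  apply Rle_antisym; [|apply Rabs_pos].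
  apply Rnot_lt_le; intros Hpos.
  set (x := Rabs _) in Hpos.
  assert (Hb : forall N, x <= C' / (k / 4) * (/ 2) ^ N).
  { intros N. unfold x; rewrite <- (Heq N).
    eapply Rle_trans; [apply (halfline_int_bound _ (k / 4) _ ltac:(lra) (Hcont N) (Hdom N))|].
    right; field; lra. }
  assert (HC' : 0 <= C' / (k / 4)).
  { specialize (Hb 0%nat); simpl in Hb; lra. }
  destruct (pow_lt_1_zero (/ 2) ltac:(rewrite Rabs_pos_eq; lra) (x / (C' / (k / 4) + 1)))
    as [N HN].
  { apply Rdiv_lt_0_compat; lra. }
  specialize (HN N (le_n N)); specialize (Hb N).
  rewrite Rabs_pos_eq in HN by (apply pow_le; lra).
  apply (Rmult_lt_compat_l (C' / (k / 4) + 1)) in HN; [|lra].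
  replace ((C' / (k / 4) + 1) * (x / (C' / (k / 4) + 1))) with x in HN
    by (set (Y := C' / (k / 4)) in *; field; lra).
  assert (0 < (/ 2) ^ N) by (apply pow_lt; lra). lra.
Qed.

Lemma null_moments_ext f g :
  (forall t, 0 <= t -> f t = g t) -> null_moments f -> null_moments g.
Proof.
  intros H Hm n; rewrite <- (Hm n); apply halfline_int_ext.
  intros t Ht; now rewrite H.
Qed.

(** The shift is made in [N] steps of length [s / N <= k / 4]. A factor [exp (- s t)] does not spoil
    the bound by [C] and [k], so the admissible step never shrinks. *)
Lemma null_moments_shift C k s (f : R -> R) :
  0 < k -> 0 <= s -> (forall t, continuous f t) -> exp_dominated C k f ->
  null_moments f -> null_moments (fun t => exp (- s * t) * f t).
Proof.
  intros Hk Hs Hc Hd Hm.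
  destruct (INR_unbounded (s / (k / 4))) as [N0 HN0].
  set (N := S N0).
  assert (HN : s / (k / 4) < INR N) by (unfold N; rewrite S_INR; lra).
  assert (HNp : 0 < INR N) by (unfold N; rewrite S_INR; pose proof (pos_INR N0); lra).
  assert (Hsig : 0 <= s / INR N <= k / 4).
  { split; [apply Rdiv_le_0_compat; lra|].
    apply (Rmult_le_reg_r (INR N)); [lra|].
    unfold Rdiv at 1; rewrite Rmult_assoc, Rinv_l, Rmult_1_r by lra.
    apply (Rmult_lt_compat_r (k / 4)) in HN; [|lra].
    unfold Rdiv at 1 in HN; rewrite Rmult_assoc, Rinv_l, Rmult_1_r in HN by lra. lra. }
  assert (Hj : forall j, null_moments (fun t => exp (- (INR j * (s / INR N)) * t) * f t)).
  { induction j as [|j IH].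
    - apply (null_moments_ext f); auto.
      intros t _; simpl. rewrite Rmult_0_l, Ropp_0, Rmult_0_l, exp_0; ring.
    - apply (null_moments_ext (fun t => exp (- (s / INR N) * t)
               * (exp (- (INR j * (s / INR N)) * t) * f t))).
      + intros t _. rewrite S_INR, <- Rmult_assoc, <- exp_plus. f_equal; f_equal; ring.
      + apply (null_moments_shift_small C k); auto.
        * intros t; now apply cont_exp_mult.
        * apply exp_dominated_shift; auto.
          apply Rmult_le_pos; [apply pos_INR | lra]. }
  apply (null_moments_ext _ _ ) with (2 := Hj N).
  intros t _; f_equal; f_equal. field; lra.
Qed.

Lemma pow_dominates q1 q2 x y : 0 < q2 < q1 -> 0 < x -> exists n, y * q2 ^ n < x * q1 ^ n.
Proof.
  intros Hq Hx.
  destruct (Rle_or_lt y 0) as [Hy | Hy].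
  { exists 0%nat; simpl; nra. }
  assert (Hr : 1 < q1 / q2).
  { apply (Rmult_lt_reg_r q2); [lra|].
    unfold Rdiv; rewrite Rmult_assoc, Rinv_l by lra; lra. }
  destruct (Pow_x_infinity (q1 / q2) ltac:(rewrite Rabs_pos_eq; lra) (y / x + 1)) as [n Hn].
  exists n; specialize (Hn n (le_n n)).
  assert (Hrn : 0 < (q1 / q2) ^ n) by (apply pow_lt; lra).
  rewrite Rabs_pos_eq in Hn by lra.
  replace (q1 ^ n) with ((q1 / q2) ^ n * q2 ^ n).
  - rewrite <- Rmult_assoc. apply Rmult_lt_compat_r; [apply pow_lt; lra|].
    apply Rge_le in Hn; apply (Rmult_le_compat_l x) in Hn; [|lra].
    replace (x * (y / x + 1)) with (y + x) in Hn by (field; lra). lra.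
  - rewrite <- Rpow_mult_distr. f_equal; field; lra.
Qed.

(** The rate [/ t0] places the maximum at [t0]. The powers are monomials times exponentials
    ([peak_pow]), exactly the functions that shifted moments test against. *)
Definition peak (t0 t : R) : R := t * exp (- / t0 * t).

Lemma peak_deriv t0 t : t0 <> 0 ->
  derivable_pt_lim (peak t0) t ((1 - t / t0) * exp (- / t0 * t)).
Proof. intros H; apply is_derive_Reals; unfold peak; auto_derive; [auto | field; auto]. Qed.

Lemma peak_incr t0 x y : 0 < t0 -> x < y <= t0 -> peak t0 x < peak t0 y.
Proof.
  intros H0 Hxy.
  destruct (MVT_cor2 (peak t0) _ x y ltac:(lra) (fun z _ => peak_deriv t0 z ltac:(lra)))
    as (z & Hz & Hz').
  assert (0 < 1 - z / t0).
  { apply (Rmult_lt_reg_r t0); [lra|]. field_simplify; lra. }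
  pose proof (exp_pos (- / t0 * z)).
  assert (0 < (1 - z / t0) * exp (- / t0 * z) * (y - x)); [|lra].
  apply Rmult_lt_0_compat; [apply Rmult_lt_0_compat|]; lra.
Qed.

Lemma peak_decr t0 x y : 0 < t0 -> t0 <= x < y -> peak t0 y < peak t0 x.
Proof.
  intros H0 Hxy.
  destruct (MVT_cor2 (peak t0) _ x y ltac:(lra) (fun z _ => peak_deriv t0 z ltac:(lra)))
    as (z & Hz & Hz').
  assert (0 < z / t0 - 1).
  { apply (Rmult_lt_reg_r t0); [lra|]. field_simplify; lra. }
  pose proof (exp_pos (- / t0 * z)).
  assert (0 < (z / t0 - 1) * exp (- / t0 * z) * (y - x)); [|lra].
  apply Rmult_lt_0_compat; [apply Rmult_lt_0_compat|]; lra.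
Qed.

Lemma peak_pow t0 n t : peak t0 t ^ n = t ^ n * exp (- (INR n / t0) * t).
Proof.
  unfold peak; rewrite Rpow_mult_distr; f_equal.
  rewrite <- Rpower_pow by apply exp_pos.
  unfold Rpower; rewrite ln_exp. f_equal; unfold Rdiv; ring.
Qed.

Lemma peak_cont t0 t : t0 <> 0 -> continuous (peak t0) t.
Proof. intros; unfold peak; cont_elem. Qed.

Lemma cont_near (f : R -> R) x eps : continuous f x -> 0 < eps ->
  exists del, 0 < del /\ forall y, Rabs (y - x) <= del -> Rabs (f y - f x) < eps.
Proof.
  intros Hc He. apply continuity_pt_filterlim in Hc.
  destruct (Hc eps He) as (del & Hd & H).
  exists (del / 2); split; [lra|]; intros y Hy.
  destruct (Req_dec y x) as [-> | Hn].
  - rewrite Rminus_diag, Rabs_R0; exact He.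
  - apply (H y); repeat split; auto. simpl; unfold Rdist; lra.
Qed.

(* [peak t0 ^ n] concentrates at [t0] as [n] grows, and pairs to zero with [f]
   for every [n] by [null_moments_shift]. *)
Lemma null_moments_nonpos C k (f : R -> R) t0 :
  0 < k -> (forall t, continuous f t) -> exp_dominated C k f -> null_moments f ->
  0 < t0 -> f t0 <= 0.
Proof.
  intros Hk Hc Hd Hm Ht0.
  apply Rnot_lt_le; intros Hpos.
  pose proof (exp_dominated_C _ _ _ Hd) as HC.
  assert (HCk : 0 <= C / k) by (apply Rdiv_le_0_compat; lra).
  destruct (cont_near f t0 (f t0 / 2) (Hc t0) ltac:(lra)) as (del0 & Hdel0 & Hnear).
  set (del := Rmin del0 (t0 / 2)).
  assert (Hdel : 0 < del <= t0 / 2 /\ del <= del0).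
  { unfold del; repeat split; [apply Rmin_pos; lra | apply Rmin_r | apply Rmin_l]. }
  assert (Hf : forall t, t0 - del <= t <= t0 + del -> f t0 / 2 <= f t).
  { intros t Ht; specialize (Hnear t ltac:(apply Rabs_le; lra)).
    apply Rabs_def2 in Hnear; lra. }
  clearbody del; clear Hnear.
  (* By monotonicity on each side of [t0], [q2] bounds the peak everywhere outside the window of
     radius [del]. *)
  set (q2 := Rmax (peak t0 (t0 - del)) (peak t0 (t0 + del))).
  assert (Hq2 : 0 < q2 < peak t0 t0).
  { split.
    - eapply Rlt_le_trans; [|apply Rmax_l]. unfold peak.
      apply Rmult_lt_0_compat; [lra | apply exp_pos].
    - unfold q2; apply Rmax_lub_lt; [apply peak_incr | apply peak_decr]; lra. }
  destruct (cont_near (peak t0) t0 ((peak t0 t0 - q2) / 2) (peak_cont t0 t0 ltac:(lra)) ltac:(lra))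
    as (del1 & Hdel1 & Hnear1).
  set (e := Rmin del1 del).
  assert (He : 0 < e <= del /\ e <= del1).
  { unfold e; repeat split; [apply Rmin_pos; lra | apply Rmin_r | apply Rmin_l]. }
  clearbody e.
  (* Any level strictly between [q2] and the maximum would do; the peak stays above it on the
     smaller window of radius [e]. *)
  set (q1 := (peak t0 t0 + q2) / 2).
  assert (Hpk1 : forall t, t0 - e <= t <= t0 + e -> q1 <= peak t0 t).
  { intros t Ht; specialize (Hnear1 t ltac:(apply Rabs_le; lra)).
    apply Rabs_def2 in Hnear1; unfold q1; lra. }
  clear Hnear1.
  assert (Hpk0 : forall t, 0 <= t -> 0 <= peak t0 t).
  { intros t Ht; apply Rmult_le_pos; [exact Ht | left; apply exp_pos]. }
  assert (Hpk2 : forall t, 0 <= t <= t0 - del \/ t0 + del <= t -> peak t0 t <= q2).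
  { intros t [Ht | Ht].
    - eapply Rle_trans; [|apply Rmax_l].
      destruct (Req_dec t (t0 - del)) as [-> | Hn]; [lra | left; apply peak_incr; lra].
    - eapply Rle_trans; [|apply Rmax_r].
      destruct (Req_dec t (t0 + del)) as [-> | Hn]; [lra | left; apply peak_decr; lra]. }
  (* For this [n] the mass within [e] of [t0] exceeds both tails together. Between the two windows
     [f] is positive, so that part of the integral can only help. *)
  destruct (pow_dominates q1 q2 (2 * e * (f t0 / 2)) (2 * (C / k))) as [n Hn].
  { unfold q1; lra. }
  { apply Rmult_lt_0_compat; lra. }
  set (F := fun t => peak t0 t ^ n * f t).
  assert (HF : halfline_int F = 0).
  { rewrite <- (null_moments_shift C k (INR n / t0) f Hk) with (n := n); auto.
    - apply halfline_int_ext; intros t _; unfold F; rewrite peak_pow; ring.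
    - apply Rdiv_le_0_compat; [apply pos_INR | exact Ht0]. }
  assert (cF : forall t, continuous F t).
  { intros t; apply cont_mult; auto. unfold peak; cont_elem. }
  assert (Hdec : forall x y, x <= y -> exp (- k * y) <= exp (- k * x)).
  { intros x y Hxy; destruct (Req_dec x y) as [-> | Hne]; [lra|].
    left; apply exp_increasing; nra. }
  assert (Hout : forall x y, 0 <= x <= y -> (y <= t0 - del \/ t0 + del <= x) ->
            - (q2 ^ n * (C / k)) <= RInt F x y).
  { intros x y Hxy Hor.
    assert (HA : Rabs (RInt F x y) <= q2 ^ n * (C / k) * (exp (- k * x) - exp (- k * y))).
    { eapply Rle_trans; [apply abs_RInt_le; [lra | now apply ex_RInt_cont]|].
      replace (q2 ^ n * (C / k) * (exp (- k * x) - exp (- k * y)))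
        with (q2 ^ n * C / k * (exp (- k * x) - exp (- k * y))) by (field; lra).
      rewrite <- (is_RInt_unique _ _ _ _ (RInt_exp (q2 ^ n * C) k x y ltac:(lra))).
      apply RInt_le; [lra | | eexists; apply RInt_exp; lra |].
      - apply ex_RInt_cont; intros t.
        apply (continuous_comp F Rabs); [apply cF | apply continuous_Rabs].
      - intros t Ht. unfold F; rewrite Rabs_mult.
        rewrite (Rabs_pos_eq (peak t0 t ^ n)) by (apply pow_le, Hpk0; lra).
        rewrite Rmult_assoc. apply Rmult_le_compat; auto using Rabs_pos.
        + apply pow_le, Hpk0; lra.
        + apply pow_incr; split; [apply Hpk0; lra | apply Hpk2; lra].
        + apply Hd; lra. }
    assert (H0 : 0 <= q2 ^ n * (C / k)).
    { apply Rmult_le_pos; [apply pow_le; lra | exact HCk]. }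
    assert (exp (- k * x) - exp (- k * y) <= 1).
    { specialize (Hdec 0 x ltac:(lra)). rewrite Rmult_0_r, exp_0 in Hdec.
      pose proof (exp_pos (- k * y)); lra. }
    apply Rabs_le_between in HA.
    assert (0 <= exp (- k * x) - exp (- k * y)) by (specialize (Hdec x y); lra). nra. }
  assert (Hin : forall x y, t0 - del <= x <= y -> y <= t0 + del -> 0 <= RInt F x y).
  { intros x y Hx Hy.
    apply RInt_ge_0; [lra | now apply ex_RInt_cont |].
    intros t Ht; unfold F; apply Rmult_le_pos; [apply pow_le, Hpk0; lra|].
    specialize (Hf t ltac:(lra)); lra. }
  assert (Hmid : 2 * e * (f t0 / 2) * q1 ^ n <= RInt F (t0 - e) (t0 + e)).
  { replace (2 * e * (f t0 / 2) * q1 ^ n)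
      with (RInt (fun _ => q1 ^ n * (f t0 / 2)) (t0 - e) (t0 + e)).
    - apply RInt_le; [lra | apply ex_RInt_const | now apply ex_RInt_cont |].
      intros t Ht; unfold F.
      assert (0 <= q1) by (unfold q1; lra).
      apply Rmult_le_compat; [now apply pow_le | lra | | apply Hf; lra].
      apply pow_incr; split; auto. apply Hpk1; lra.
    - rewrite RInt_const; unfold scal; simpl; unfold mult; simpl. lra. }
  assert (Hlow : forall y, t0 + del <= y ->
     2 * e * (f t0 / 2) * q1 ^ n - 2 * (C / k) * q2 ^ n <= RInt F 0 y).
  { intros y Hy.
    rewrite (RInt_split F 0 (t0 - del) y), (RInt_split F (t0 - del) (t0 - e) y),
      (RInt_split F (t0 - e) (t0 + e) y), (RInt_split F (t0 + e) (t0 + del) y) by auto.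
    pose proof (Hout 0 (t0 - del) ltac:(lra) ltac:(lra)).
    pose proof (Hout (t0 + del) y ltac:(lra) ltac:(lra)).
    pose proof (Hin (t0 - del) (t0 - e) ltac:(lra) ltac:(lra)).
    pose proof (Hin (t0 + e) (t0 + del) ltac:(lra) ltac:(lra)).
    lra. }
  assert (HL : is_lim_seq (fun n => RInt F 0 (INR n)) (halfline_int F)).
  { apply (halfline_int_lim (INR (fact n) / (k / 2) ^ n * C) (k / 2)); [lra | exact cF |].
    intros t Ht.
    replace (F t) with (t ^ n * (exp (- (INR n / t0) * t) * f t))
      by (unfold F; rewrite peak_pow; ring).
    revert t Ht; apply exp_dominated_pow, exp_dominated_shift; auto.
    apply Rdiv_le_0_compat; [apply pos_INR | exact Ht0]. }
  rewrite HF in HL.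
  destruct (INR_unbounded (t0 + del)) as [N HN].
  assert (Hle : Rbar_le (2 * e * (f t0 / 2) * q1 ^ n - 2 * (C / k) * q2 ^ n) 0).
  { apply (is_lim_seq_le_loc (fun _ => 2 * e * (f t0 / 2) * q1 ^ n - 2 * (C / k) * q2 ^ n)
             (fun n => RInt F 0 (INR n))); auto using is_lim_seq_const.
    exists N; intros j Hj; apply Hlow; apply le_INR in Hj; lra. }
  simpl in Hle; lra.
Qed.

Lemma null_moments_zero C k (f : R -> R) t0 :
  0 < k -> (forall t, continuous f t) -> exp_dominated C k f -> null_moments f ->
  0 < t0 -> f t0 = 0.
Proof.
  intros Hk Hc Hd Hm Ht0.
  apply Rle_antisym; [now apply (null_moments_nonpos C k)|].
  enough (- f t0 <= 0) by lra.
  apply (null_moments_nonpos C k (fun t => - f t)); auto.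
  - intros t; now apply (continuous_opp (V := R_NormedModule)).
  - intros t Ht; rewrite Rabs_Ropp; now apply Hd.
  - intros n.
    transitivity (halfline_int (fun t => (-1) * (t ^ n * f t) + 0 * (t ^ n * f t))).
    { apply halfline_int_ext; intros; ring. }
    rewrite (halfline_int_lin (INR (fact n) / (k / 2) ^ n * C) (k / 2)
               (INR (fact n) / (k / 2) ^ n * C) (k / 2));
      try lra; try (intros; now apply cont_pow_mult); try now apply exp_dominated_pow.
    rewrite (Hm n); ring.
Qed.

(** * Energy estimate for the dual equation *)

Section Energy.

Variables (d q am : R) (w Lam : Cx).
Hypotheses (Hd : 0 < d) (Hq : 0 <= q) (Hw : 0 < Im w).
Hypothesis HLam :
  Re w * Im Lam - Im w * Re Lam <= q * (q + d) * (Re w ^ 2 + Im w ^ 2) * Im w.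

(** The value of [K] at [r = q], where [r^2 + a^2 = q (2 q + d)] because [a^2 = q (q + d)]. *)
Definition Kq : Cx := Csub (Cscale (q * (2 * q + d)) w) (RtoC am).

(** The adjoint of the radial operator, applied to [exp (c y t)] with [c = 2 i w / d], is a
    quadratic polynomial in [t] times the kernel. Reading [(c t) ^ n] as the [n]-th derivative in
    [y] gives the leading coefficient [y (y - d)] and the two coefficients defined here. *)
Definition dual_coef1 (y : R) : Cx :=
  Csub (RtoC (2 * y - d)) (Cscale (2 * y * (y + 2 * q)) (Cmul Ci w)).

Definition dual_coef0 (y : R) : Cx :=
  Csub (Cscale y (Csub (Cscale (4 / d) (Cmul Kq w)) (Cscale 2 (Cmul Ci w))))
       (Cadd (Cscale (2 * q) (Cmul Ci w)) Lam).

(** Put [s = y + (2 q + d) ln (y - d)], so that [s' = (y + 2 q) / (y - d)]. Then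
    [X = exp (- i w s) V] satisfies [(y (y - d) X')' + Psi X = 0], without a further first order
    term; the weight is [|exp (- i w s)|^2]. *)
Definition dual_weight (y : R) : R :=
  exp (2 * Im w * (y + (2 * q + d) * ln (y - d))).

(** This is [y (y - d) X'] stripped of the factor [exp (- i w s)]. With the weight restored,
    [dual_energy] is [Im (conj w y (y - d) X' conj X)]. *)
Definition dual_flux (V0 V1 : R -> Cx) (y : R) : Cx :=
  Cscale y (Csub (Cscale (y - d) (V1 y)) (Cscale (y + 2 * q) (Cmul Ci (Cmul w (V0 y))))).

Definition dual_energy (V0 V1 : R -> Cx) (y : R) : R :=
  dual_weight y *
  (Re w * (Im (dual_flux V0 V1 y) * Re (V0 y) - Re (dual_flux V0 V1 y) * Im (V0 y))
   - Im w * (Re (dual_flux V0 V1 y) * Re (V0 y) + Im (dual_flux V0 V1 y) * Im (V0 y))).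

(* The imaginary part of [conj w] times the potential of the dual equation. *)
Definition dual_pot (y : R) : R :=
  4 * y / d * (Re w ^ 2 + Im w ^ 2) * (q * (2 * q + d)) * Im w
  - (Re w * Im Lam - Im w * Re Lam)
  + (Re w ^ 2 + Im w ^ 2) * Im w * ((y + 2 * q) ^ 2 * y / (y - d)).

(** Only the term in [Lam] has an open sign, and [HLam] bounds it. Since [y / (y - d) >= 1], the
    last term is at least [|w|^2 Im w (y + 2 q)^2], and [(y + 2 q)^2 > q (q + d)] for [y > d]. *)
Lemma dual_pot_pos y : d < y -> 0 < dual_pot y.
Proof.
  intros Hy; unfold dual_pot.
  assert (Hn : 0 < (Re w ^ 2 + Im w ^ 2) * Im w).
  { apply Rmult_lt_0_compat; [|exact Hw].
    pose proof (pow2_ge_0 (Re w)); pose proof (pow_lt _ 2 Hw); lra. }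
  assert (H1 : 0 <= 4 * y / d * (Re w ^ 2 + Im w ^ 2) * (q * (2 * q + d)) * Im w).
  { replace (4 * y / d * (Re w ^ 2 + Im w ^ 2) * (q * (2 * q + d)) * Im w)
      with (4 * y / d * (q * (2 * q + d)) * ((Re w ^ 2 + Im w ^ 2) * Im w)) by ring.
    apply Rmult_le_pos; [|lra].
    apply Rmult_le_pos; [apply Rdiv_le_0_compat; lra | nra]. }
  assert (H2 : (y + 2 * q) ^ 2 <= (y + 2 * q) ^ 2 * y / (y - d)).
  { apply (Rmult_le_reg_r (y - d)); [lra|].
    unfold Rdiv; rewrite (Rmult_assoc _ (/ _)), Rinv_l, Rmult_1_r by lra.
    apply Rmult_le_compat_l; [apply pow2_ge_0 | lra]. }
  assert (H3 : q * (q + d) < (y + 2 * q) ^ 2) by nra.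
  apply (Rmult_lt_compat_l _ _ _ Hn) in H3.
  apply (Rmult_le_compat_l _ _ _ (Rlt_le _ _ Hn)) in H2. lra.
Qed.

(** Multiply the equation of [X] by [conj w conj X] and take imaginary parts. The potential yields
    [- dual_pot |X|^2], and [Im (conj w) = - Im w] gives the term in [|X'|^2] the same sign. *)
Lemma dual_energy_deriv (V0 V1 V2 : R -> Cx) y :
  d < y -> derivC V0 y (V1 y) -> derivC V1 y (V2 y) ->
  Cadd (Cadd (Cscale (y * (y - d)) (V2 y)) (Cmul (dual_coef1 y) (V1 y)))
       (Cmul (dual_coef0 y) (V0 y)) = C0 ->
  derivable_pt_lim (dual_energy V0 V1) y
    (- (dual_weight y *
        (dual_pot y * (Re (V0 y) ^ 2 + Im (V0 y) ^ 2)
         + Im w * (Re (dual_flux V0 V1 y) ^ 2 + Im (dual_flux V0 V1 y) ^ 2)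
           / (y * (y - d))))).
Proof.
  (* Over real component functions [auto_derive] applies, and the second derivatives can be
     eliminated by solving the equation for them. *)
  enough (H : forall a0 b0 a1 b1 a2 b2 : R -> R,
    d < y -> is_derive a0 y (a1 y) -> is_derive b0 y (b1 y) ->
    is_derive a1 y (a2 y) -> is_derive b1 y (b2 y) ->
    let U0 y := Cmk (a0 y) (b0 y) in
    let U1 y := Cmk (a1 y) (b1 y) in
    Cadd (Cadd (Cscale (y * (y - d)) (Cmk (a2 y) (b2 y))) (Cmul (dual_coef1 y) (U1 y)))
         (Cmul (dual_coef0 y) (U0 y)) = C0 ->
    is_derive (dual_energy U0 U1) y
      (- (dual_weight y *
          (dual_pot y * (a0 y ^ 2 + b0 y ^ 2)
           + Im w * (Re (dual_flux U0 U1 y) ^ 2 + Im (dual_flux U0 U1 y) ^ 2)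
             / (y * (y - d)))))).
  { intros Hy [A0 B0] [A1 B1] Hode.
    apply is_derive_Reals.
    apply (H (fun y => Re (V0 y)) (fun y => Im (V0 y)) (fun y => Re (V1 y))
             (fun y => Im (V1 y)) (fun y => Re (V2 y)) (fun y => Im (V2 y)));
      try apply is_derive_Reals; assumption. }
  clear V0 V1 V2; intros a0 b0 a1 b1 a2 b2 Hy A0 B0 A1 B1 U0 U1 Hode.
  assert (Ea : a2 y = - (Re (Cmul (dual_coef1 y) (U1 y)) + Re (Cmul (dual_coef0 y) (U0 y)))
                             / (y * (y - d))).
  { apply (f_equal Re) in Hode. cbn [Re Cadd Cscale C0] in Hode.
    apply (Rmult_eq_reg_l (y * (y - d))); [|nra].
    transitivity (- (Re (Cmul (dual_coef1 y) (U1 y)) + Re (Cmul (dual_coef0 y) (U0 y)))); [lra|].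
    field; lra. }
  assert (Eb : b2 y = - (Im (Cmul (dual_coef1 y) (U1 y)) + Im (Cmul (dual_coef0 y) (U0 y)))
                             / (y * (y - d))).
  { apply (f_equal Im) in Hode. cbn [Im Cadd Cscale C0] in Hode.
    apply (Rmult_eq_reg_l (y * (y - d))); [|nra].
    transitivity (- (Im (Cmul (dual_coef1 y) (U1 y)) + Im (Cmul (dual_coef0 y) (U0 y)))); [lra|].
    field; lra. }
  unfold dual_energy, dual_flux, dual_weight, dual_pot, U0, U1.
  cbn [Re Im Cscale Csub Cadd Copp Cmul Ci].
  auto_derive.
  - repeat split; try (eexists; eassumption); lra.
  - change (fun x => a0 x) with a0; change (fun x => b0 x) with b0;
    change (fun x => a1 x) with a1; change (fun x => b1 x) with b1.
    rewrite (is_derive_unique a0 _ _ A0),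
      (is_derive_unique b0 _ _ B0),
      (is_derive_unique a1 _ _ A1),
      (is_derive_unique b1 _ _ B1), Ea, Eb.
    unfold dual_coef1, dual_coef0, Kq, U0, U1.
    cbn [Re Im Cscale Csub Cadd Copp Cmul Ci RtoC].
    replace (y + - d) with (y - d) by ring.
    set (T := exp _). field; lra.
Qed.

(** The weight contributes [exp (2 Im w v)] and the two factors [V] contribute [exp (- 4 Im w v)],
    leaving decay at infinity. Near [v = 0] the logarithm in the weight leaves a positive power of
    [v]. *)
Lemma dual_energy_bound (V0 V1 : R -> Cx) D : 0 <= D ->
  (forall y, d < y -> norm1 (V0 y) <= D * exp (- 2 * Im w * (y - d))) ->
  (forall y, d < y -> norm1 (V1 y) <= D * exp (- 2 * Im w * (y - d))) ->
  exists D', 0 <= D' /\ forall v, 0 < v ->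
    Rabs (dual_energy V0 V1 (d + v))
    <= D' * (1 + v) ^ 2 * exp (- 2 * Im w * v) * exp (2 * Im w * (2 * q + d) * ln v).
Proof.
  intros HD H0 H1.
  set (A := 1 + d + 2 * q).
  exists (norm1 w * (A * ((1 + 2 * A * norm1 w) * D)) * D * exp (2 * Im w * d)).
  assert (Hn := norm1_ge0 w).
  assert (HA : 1 <= A) by (unfold A; lra).
  split.
  { repeat apply Rmult_le_pos; try lra; try nra. left; apply exp_pos. }
  intros v Hv.
  specialize (H0 (d + v) ltac:(lra)); specialize (H1 (d + v) ltac:(lra)).
  replace (d + v - d) with v in * by ring.
  set (e := exp (- 2 * Im w * v)) in *.
  assert (He : 0 < e) by apply exp_pos.
  assert (HF : norm1 (dual_flux V0 V1 (d + v))
               <= A * (1 + v) * ((1 + 2 * A * norm1 w) * (1 + v) * D * e)).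
  { unfold dual_flux. rewrite norm1_scale, Rabs_pos_eq by lra.
    apply Rmult_le_compat; [lra | apply norm1_ge0 | unfold A; nra |].
    eapply Rle_trans; [apply norm1_sub|].
    rewrite !norm1_scale, !Rabs_pos_eq by lra.
    assert (HI : norm1 (Cmul Ci (Cmul w (V0 (d + v)))) <= 2 * norm1 w * (D * e)).
    { replace (2 * norm1 w * (D * e)) with (2 * (norm1 w * (D * e))) by ring.
      apply norm1_mul_le; [unfold norm1; simpl; rewrite Rabs_R0, Rabs_R1; lra|].
      apply norm1_mul_le; [lra | exact H0]. }
    assert (Ha : (d + v - d) * norm1 (V1 (d + v)) <= (1 + v) * (D * e)).
    { apply Rmult_le_compat; try lra. apply norm1_ge0. }
    assert (Hb : (d + v + 2 * q) * norm1 (Cmul Ci (Cmul w (V0 (d + v))))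
                 <= (A * (1 + v)) * (2 * norm1 w * (D * e))).
    { apply Rmult_le_compat; [lra | apply norm1_ge0 | unfold A; nra | exact HI]. }
    lra. }
  unfold dual_energy. rewrite Rabs_mult.
  unfold dual_weight. replace (d + v - d) with v by ring.
  rewrite (Rabs_pos_eq (exp _)) by (left; apply exp_pos).
  replace (2 * Im w * (d + v + (2 * q + d) * ln v))
    with (2 * Im w * d + (2 * Im w * v + 2 * Im w * (2 * q + d) * ln v)) by ring.
  rewrite !exp_plus.
  assert (Hee : exp (2 * Im w * v) * e = 1).
  { unfold e; rewrite <- exp_plus, <- exp_0; f_equal; ring. }
  set (g := exp (2 * Im w * v)) in *.
  set (l := exp (2 * Im w * (2 * q + d) * ln v)).
  assert (Hl : 0 < l) by apply exp_pos.
  assert (Hg : 0 < g) by apply exp_pos.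
  set (c := exp (2 * Im w * d)); assert (Hc : 0 < c) by apply exp_pos.
  set (Z := dual_flux V0 V1 (d + v)) in *.
  assert (HE : Rabs (Re w * (Im Z * Re (V0 (d + v)) - Re Z * Im (V0 (d + v)))
                     - Im w * (Re Z * Re (V0 (d + v)) + Im Z * Im (V0 (d + v))))
               <= norm1 w * (norm1 Z * norm1 (V0 (d + v)))).
  { pose (z := Cmul (Cmk (Re w) (- Im w)) (Cmul Z (Cmk (Re (V0 (d + v))) (- Im (V0 (d + v)))))).
    replace (Re w * _ - _) with (Im z) by (simpl; ring).
    eapply Rle_trans; [apply Im_le_norm1|].
    apply norm1_mul_le; [unfold norm1; simpl; rewrite Rabs_Ropp; lra|].
    apply norm1_mul_le; [lra | unfold norm1; simpl; rewrite Rabs_Ropp; lra]. }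
  assert (HF2 : norm1 Z * norm1 (V0 (d + v)) <=
     A * (1 + v) * ((1 + 2 * A * norm1 w) * (1 + v) * D * e) * (D * e)).
  { apply Rmult_le_compat; auto using norm1_ge0. }
  apply (Rmult_le_compat_l _ _ _ Hn) in HF2.
  eapply Rle_trans.
  { apply Rmult_le_compat_l; [|eapply Rle_trans; [exact HE | exact HF2]].
    left; repeat apply Rmult_lt_0_compat; assumption. }
  right.
  transitivity (norm1 w * (A * ((1 + 2 * A * norm1 w) * D)) * D * c * (1 + v) ^ 2 * e * l
                * (g * e)); [ring | rewrite Hee; ring].
Qed.

Lemma dual_vanishes (V0 V1 V2 : R -> Cx) D : 0 <= D ->
  (forall y, d < y -> derivC V0 y (V1 y)) ->
  (forall y, d < y -> derivC V1 y (V2 y)) ->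
  (forall y, d < y ->
     Cadd (Cadd (Cscale (y * (y - d)) (V2 y)) (Cmul (dual_coef1 y) (V1 y)))
          (Cmul (dual_coef0 y) (V0 y)) = C0) ->
  (forall y, d < y -> norm1 (V0 y) <= D * exp (- 2 * Im w * (y - d))) ->
  (forall y, d < y -> norm1 (V1 y) <= D * exp (- 2 * Im w * (y - d))) ->
  forall y, d < y -> V0 y = C0.
Proof.
  intros HD D0 D1 Hode B0 B1 y Hy.
  destruct (dual_energy_bound V0 V1 D HD B0 B1) as (D' & HD' & HB).
  set (beta := 2 * Im w * (2 * q + d)) in *.
  assert (Hbeta : 0 < beta) by (unfold beta; nra).
  assert (Hzero := nonincreasing_null_ends (fun y => d < y) (dual_energy V0 V1) _
    (fun x y z Hx _ Hxy => Rlt_le_trans _ _ _ Hx (proj1 Hxy))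
    (fun y Hy => dual_energy_deriv V0 V1 V2 y Hy (D0 y Hy) (D1 y Hy) (Hode y Hy))).
  cbv beta in Hzero.
  assert (Hfl : forall x, d < x -> 0 <= Im w *
     (Re (dual_flux V0 V1 x) ^ 2 + Im (dual_flux V0 V1 x) ^ 2) / (x * (x - d))).
  { intros x Hx; apply Rdiv_le_0_compat; [|nra].
    apply Rmult_le_pos; [lra|].
    apply Rplus_le_le_0_compat; apply pow2_ge_0. }
  assert (Hpt : forall x, d < x -> 0 <= dual_pot x * (Re (V0 x) ^ 2 + Im (V0 x) ^ 2)).
  { intros x Hx; apply Rmult_le_pos; [left; now apply dual_pot_pos|].
    apply Rplus_le_le_0_compat; apply pow2_ge_0. }
  assert (Hwt : forall x, 0 < dual_weight x) by (intros; apply exp_pos).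
  assert (H0 := fun P1 P2 => Hzero P1 P2 y Hy); clear Hzero.
  assert (Hsum : dual_pot y * (Re (V0 y) ^ 2 + Im (V0 y) ^ 2) = 0).
  { specialize (Hfl y Hy) as F1; specialize (Hpt y Hy) as F2; specialize (Hwt y) as F3.
    enough (E : dual_weight y *
        (dual_pot y * (Re (V0 y) ^ 2 + Im (V0 y) ^ 2)
         + Im w * (Re (dual_flux V0 V1 y) ^ 2 + Im (dual_flux V0 V1 y) ^ 2)
           / (y * (y - d))) = 0).
    { apply Rmult_integral in E; destruct E; lra. }
    enough (E : forall x, - x = 0 -> x = 0); [apply E, H0 | intros; lra].
    - intros x Hx. specialize (Hfl x Hx); specialize (Hpt x Hx); specialize (Hwt x).
      apply Ropp_le_cancel; rewrite Ropp_involutive, Ropp_0.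
      apply Rmult_le_pos; lra.
    - intros x eps Hx He; split.
      + destruct (exp_INR_small beta (eps / (4 * D' + 1)) Hbeta) as [N1 HN1].
        { apply Rdiv_lt_0_compat; lra. }
        destruct (exp_INR_small 1 (x - d) Rlt_0_1 ltac:(lra)) as [N2 HN2].
        set (n := Nat.max N1 N2).
        specialize (HN1 n (Nat.le_max_l _ _)); specialize (HN2 n (Nat.le_max_r _ _)).
        (* This choice turns the power [v ^ beta] into [exp (- beta n)]. *)
        set (v := exp (- (1) * INR n)).
        assert (Hv : 0 < v) by apply exp_pos.
        assert (Hv1 : v <= 1).
        { apply Rle_trans with (exp 0); [|rewrite exp_0; lra].
          unfold v; destruct (Req_dec (INR n) 0) as [-> | Hn].
          - right; f_equal; ring.
          - left; apply exp_increasing; pose proof (pos_INR n).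
            assert (0 < INR n) by lra. lra. }
        exists (d + v); repeat split; [lra | fold v in HN2; lra |].
        eapply Rle_lt_trans; [apply (HB v Hv)|].
        unfold v at 3; rewrite ln_exp.
        replace (beta * (- (1) * INR n)) with (- beta * INR n) by ring.
        set (b := exp (- beta * INR n)) in *.
        assert (Hb : 0 < b) by apply exp_pos.
        assert (He1 : exp (- 2 * Im w * v) <= 1).
        { rewrite <- exp_0; left; apply exp_increasing; nra. }
        pose proof (exp_pos (- 2 * Im w * v)) as He0.
        apply (Rmult_lt_compat_l (4 * D' + 1)) in HN1; [|lra].
        replace ((4 * D' + 1) * (eps / (4 * D' + 1))) with eps in HN1 by (field; lra).
        assert (Hsq : D' * (1 + v) ^ 2 <= D' * 4) by (apply Rmult_le_compat_l; nra).
        assert (D' * (1 + v) ^ 2 * exp (- 2 * Im w * v) <= D' * 4 * 1).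
        { apply Rmult_le_compat; try lra.
          apply Rmult_le_pos; [lra | apply pow2_ge_0]. }
        apply Rle_lt_trans with (D' * 4 * 1 * b); [apply Rmult_le_compat_r; lra|]. lra.
      (* An integer [j > beta] replaces the real power. Then [v ^ (j + 2)], whose extra square comes
         from [(1 + v) ^ 2], costs half of the rate [2 Im w]. *)
      + destruct (INR_unbounded beta) as [j Hj].
        set (P := INR (fact (j + 2)) / Im w ^ (j + 2)).
        assert (HP : 0 < P).
        { apply Rdiv_lt_0_compat; [apply INR_fact_lt_0 | now apply pow_lt]. }
        destruct (exp_INR_small (Im w) (eps / (4 * D' * P + 1)) Hw) as [N1 HN1].
        { assert (0 <= 4 * D' * P) by (apply Rmult_le_pos; lra). apply Rdiv_lt_0_compat; lra. }
        destruct (INR_unbounded (x + 1)) as [N2 HN2].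
        set (n := Nat.max N1 N2).
        specialize (HN1 n (Nat.le_max_l _ _)).
        assert (Hn : x + 1 < INR n).
        { pose proof (le_INR _ _ (Nat.le_max_r N1 N2)); unfold n; lra. }
        set (v := INR n) in *.
        exists (d + v); repeat split; [lra | lra |].
        eapply Rle_lt_trans; [apply (HB v ltac:(lra))|].
        assert (H1 : exp (beta * ln v) <= v ^ j).
        { rewrite <- Rpower_pow by lra. unfold Rpower.
          assert (0 < ln v) by (rewrite <- ln_1; apply ln_increasing; lra).
          left; apply exp_increasing; nra. }
        pose proof (pow_le_exp (j + 2) (Im w) v Hw ltac:(lra)) as H2; fold P in H2.
        assert (Hvj : 0 < v ^ j) by (apply pow_lt; lra).
        pose proof (exp_pos (beta * ln v)) as Hp1.
        pose proof (exp_pos (- 2 * Im w * v)) as Hp2.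
        assert (Hsplit : exp (Im w * v) * exp (- 2 * Im w * v) = exp (- Im w * v)).
        { rewrite <- exp_plus; f_equal; ring. }
        set (E2 := exp (- 2 * Im w * v)) in *.
        set (E1 := exp (- Im w * v)) in *.
        assert (HE1 : 0 < E1) by apply exp_pos.
        apply Rle_lt_trans with (4 * D' * P * E1).
        * rewrite <- Hsplit.
          transitivity (D' * (4 * v ^ 2) * E2 * v ^ j).
          -- apply Rmult_le_compat; [| lra | | exact H1].
             ++ apply Rmult_le_pos; [|lra]. apply Rmult_le_pos; [lra | apply pow2_ge_0].
             ++ apply Rmult_le_compat_r; [lra|]. apply Rmult_le_compat_l; [lra | nra].
          -- rewrite pow_add in H2.
             replace (D' * (4 * v ^ 2) * E2 * v ^ j) with (4 * D' * E2 * (v ^ j * v ^ 2)) by ring.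
             replace (4 * D' * P * (exp (Im w * v) * E2))
               with (4 * D' * E2 * (P * exp (Im w * v))) by ring.
             apply Rmult_le_compat_l; [|exact H2]. apply Rmult_le_pos; lra.
        * assert (HDP : 0 <= 4 * D' * P) by (apply Rmult_le_pos; lra).
          apply (Rmult_lt_compat_l (4 * D' * P + 1)) in HN1; [|lra].
          replace ((4 * D' * P + 1) * (eps / (4 * D' * P + 1))) with eps in HN1
            by (field; lra). lra. }
  pose proof (dual_pot_pos y Hy).
  apply Rmult_integral in Hsum; destruct Hsum as [Hs | Hs]; [lra|].
  apply Cx_eq; simpl; nra.
Qed.

End Energy.

(** * The Whiting transform *)

Definition Cint (f : R -> Cx) : Cx :=
  Cmk (halfline_int (fun t => Re (f t))) (halfline_int (fun t => Im (f t))).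

Definition continuousC (f : R -> Cx) : Prop :=
  forall t, continuous (fun t => Re (f t)) t /\ continuous (fun t => Im (f t)) t.

Definition dominatedC (C k : R) (f : R -> Cx) : Prop :=
  forall t, 0 <= t -> norm1 (f t) <= C * exp (- k * t).

Definition tame (k : R) (f : R -> Cx) : Prop :=
  continuousC f /\ exists C, dominatedC C k f.

Lemma dominatedC_Re C k f : dominatedC C k f -> exp_dominated C k (fun t => Re (f t)).
Proof. intros H t Ht; eapply Rle_trans; [apply Re_le_norm1 | now apply H]. Qed.

Lemma dominatedC_Im C k f : dominatedC C k f -> exp_dominated C k (fun t => Im (f t)).
Proof. intros H t Ht; eapply Rle_trans; [apply Im_le_norm1 | now apply H]. Qed.

Lemma continuousC_add f g : continuousC f -> continuousC g ->
  continuousC (fun t => Cadd (f t) (g t)).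
Proof.
  intros Hf Hg t; destruct (Hf t), (Hg t).
  split; apply (continuous_plus (V := R_NormedModule)); assumption.
Qed.

Lemma continuousC_mul f g : continuousC f -> continuousC g ->
  continuousC (fun t => Cmul (f t) (g t)).
Proof.
  intros Hf Hg t; destruct (Hf t), (Hg t); simpl; split.
  - apply (continuous_minus (V := R_NormedModule)); now apply cont_mult.
  - apply (continuous_plus (V := R_NormedModule)); now apply cont_mult.
Qed.

Lemma continuousC_const z : continuousC (fun _ => z).
Proof. intros t; split; apply continuous_const. Qed.

Lemma dominatedC_add C1 C2 k f g : dominatedC C1 k f -> dominatedC C2 k g ->
  dominatedC (C1 + C2) k (fun t => Cadd (f t) (g t)).
Proof.
  intros Hf Hg t Ht; eapply Rle_trans; [apply norm1_add|].
  specialize (Hf t Ht); specialize (Hg t Ht); lra.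
Qed.

Lemma dominatedC_const_mul C k z f : dominatedC C k f ->
  dominatedC (norm1 z * C) k (fun t => Cmul z (f t)).
Proof.
  intros Hf t Ht; rewrite Rmult_assoc; apply norm1_mul_le; [lra | now apply Hf].
Qed.

Lemma tame_add k f g : tame k f -> tame k g -> tame k (fun t => Cadd (f t) (g t)).
Proof.
  intros [Hf (C1 & D1)] [Hg (C2 & D2)]; split; [now apply continuousC_add|].
  exists (C1 + C2); now apply dominatedC_add.
Qed.

Lemma tame_const_mul k z f : tame k f -> tame k (fun t => Cmul z (f t)).
Proof.
  intros [Hf (C1 & D1)]; split.
  - apply continuousC_mul; [apply continuousC_const | exact Hf].
  - exists (norm1 z * C1); now apply dominatedC_const_mul.
Qed.

Lemma Cint_add k f g : 0 < k -> tame k f -> tame k g ->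
  Cint (fun t => Cadd (f t) (g t)) = Cadd (Cint f) (Cint g).
Proof.
  intros Hk [Hf (C1 & D1)] [Hg (C2 & D2)].
  assert (H : forall p : Cx -> R, (forall z v, p (Cadd z v) = p z + p v) ->
    (forall t, continuous (fun t => p (f t)) t) -> (forall t, continuous (fun t => p (g t)) t) ->
    exp_dominated C1 k (fun t => p (f t)) -> exp_dominated C2 k (fun t => p (g t)) ->
    halfline_int (fun t => p (Cadd (f t) (g t)))
    = halfline_int (fun t => p (f t)) + halfline_int (fun t => p (g t))).
  { intros p Hp Kf Kg Ef Eg.
    transitivity (halfline_int (fun t => 1 * p (f t) + 1 * p (g t))).
    - apply halfline_int_ext; intros t _; rewrite Hp; ring.
    - rewrite (halfline_int_lin C1 k C2 k); auto; ring. }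
  apply Cx_eq; [apply (H Re) | apply (H Im)];
    auto using dominatedC_Re, dominatedC_Im; intros t; apply (Hf t) || apply (Hg t).
Qed.

Lemma Cint_const_mul k z f : 0 < k -> tame k f ->
  Cint (fun t => Cmul z (f t)) = Cmul z (Cint f).
Proof.
  intros Hk [Hf (C1 & D1)].
  assert (H : forall x y, halfline_int (fun t => x * Re (f t) + y * Im (f t))
    = x * halfline_int (fun t => Re (f t)) + y * halfline_int (fun t => Im (f t))).
  { intros x y; apply (halfline_int_lin C1 k C1 k);
      auto using dominatedC_Re, dominatedC_Im; intros t; apply (Hf t). }
  apply Cx_eq; simpl.
  - transitivity (Re z * halfline_int (fun t => Re (f t))
                  + - Im z * halfline_int (fun t => Im (f t))); [|ring].
    rewrite <- H; apply halfline_int_ext; intros; ring.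
  - transitivity (Im z * halfline_int (fun t => Re (f t))
                  + Re z * halfline_int (fun t => Im (f t))); [|ring].
    rewrite <- H; apply halfline_int_ext; intros; ring.
Qed.

Lemma Cint_bound C k f : 0 < k -> continuousC f -> dominatedC C k f ->
  norm1 (Cint f) <= 2 * (C / k).
Proof.
  intros Hk Hc Hd; unfold norm1; simpl.
  pose proof (halfline_int_bound C k (fun t : R => Re (f t)) Hk
                (fun t => proj1 (Hc t)) (dominatedC_Re _ _ _ Hd)) as H1.
  pose proof (halfline_int_bound C k (fun t : R => Im (f t)) Hk
                (fun t => proj2 (Hc t)) (dominatedC_Im _ _ _ Hd)) as H2.
  simpl in H1, H2; lra.
Qed.

Lemma Cint_derivative_zero (f B : R -> Cx) d C k :
  0 <= d -> 0 < k -> continuousC f ->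
  (forall t, t <= d -> f t = C0) -> (forall t, t <= d -> B t = C0) ->
  continuousC B -> dominatedC C k B ->
  (forall t, d < t -> derivC B t (f t)) ->
  Cint f = C0.
Proof.
  intros Hd Hk Hf f0 B0 HB DB Hder.
  apply Cx_eq; simpl.
  - apply (halfline_int_derivative_zero _ (fun t => Re (B t)) d C k); auto.
    + intros t; apply (Hf t).
    + intros t Ht; now rewrite f0.
    + intros t Ht; now rewrite B0.
    + intros t; apply (HB t).
    + now apply dominatedC_Re.
    + intros t Ht; apply (Hder t Ht).
  - apply (halfline_int_derivative_zero _ (fun t => Im (B t)) d C k); auto.
    + intros t; apply (Hf t).
    + intros t Ht; now rewrite f0.
    + intros t Ht; now rewrite B0.
    + intros t; apply (HB t).
    + now apply dominatedC_Im.
    + intros t Ht; apply (Hder t Ht).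
Qed.

Lemma Cint_leibniz (f f1 f2 : R -> R -> Cx) y0 l C k :
  0 < k -> l < y0 ->
  (forall y t, l < y -> derivC (fun y => f y t) y (f1 y t)) ->
  (forall y t, l < y -> derivC (fun y => f1 y t) y (f2 y t)) ->
  (forall y, l < y -> continuousC (f y)) -> continuousC (f1 y0) ->
  (forall y, l < y -> dominatedC C k (f y)) -> dominatedC C k (f1 y0) ->
  (forall y, l < y -> dominatedC C k (f2 y)) ->
  derivC (fun y => Cint (f y)) y0 (Cint (f1 y0)).
Proof.
  intros Hk Hl D1 D2 Cf Cf1 Ef Ef1 Ef2; split; simpl.
  - apply (halfline_int_leibniz (fun y t => Re (f y t)) (fun y t => Re (f1 y t))
             (fun y t => Re (f2 y t)) y0 l C k); auto using dominatedC_Re.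
    + intros y t Hy _; apply (D1 y t Hy).
    + intros y t Hy _; apply (D2 y t Hy).
    + intros y t Hy; apply (Cf y Hy t).
    + intros t; apply (Cf1 t).
  - apply (halfline_int_leibniz (fun y t => Im (f y t)) (fun y t => Im (f1 y t))
             (fun y t => Im (f2 y t)) y0 l C k); auto using dominatedC_Im.
    + intros y t Hy _; apply (D1 y t Hy).
    + intros y t Hy _; apply (D2 y t Hy).
    + intros y t Hy; apply (Cf y Hy t).
    + intros t; apply (Cf1 t).
Qed.

Lemma Cexp_mul_eq0 z v : Cmul (Cexp z) v = C0 -> v = C0.
Proof.
  intros H.
  assert (H1 := f_equal Re H); assert (H2 := f_equal Im H); simpl in H1, H2.
  pose proof (exp_pos (Re z)) as He; pose proof (sin2_cos2 (Im z)) as Hsc; unfold Rsqr in Hsc.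
  set (e := exp (Re z)) in *; set (s := sin (Im z)) in *; set (c := cos (Im z)) in *.
  apply Cx_eq; simpl; apply (Rmult_eq_reg_l e); try lra.
  - transitivity (c * (e * c * Re v - e * s * Im v) + s * (e * c * Im v + e * s * Re v)).
    + transitivity (e * Re v * (s * s + c * c)); [rewrite Hsc; ring | ring].
    + rewrite H1, H2; ring.
  - transitivity (c * (e * c * Im v + e * s * Re v) - s * (e * c * Re v - e * s * Im v)).
    + transitivity (e * Im v * (s * s + c * c)); [rewrite Hsc; ring | ring].
    + rewrite H1, H2; ring.
Qed.

Section Transform.

Variables (d q am : R) (w Lam : Cx).
Hypotheses (Hd : 0 < d) (Hq : 0 <= q) (Hw : 0 < Im w).
Hypothesis HLam :
  Re w * Im Lam - Im w * Re Lam <= q * (q + d) * (Re w ^ 2 + Im w ^ 2) * Im w.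

(** [K] in the variable [t = r - q], with [a^2] written as [q (q + d)]; the horizons then lie at
    [t = 0] and [t = d]. *)
Definition Kpot (t : R) : Cx :=
  Csub (Cscale ((t + q) ^ 2 + q * (q + d)) w) (RtoC am).

Variables (h k : R -> Cx) (C : R).
Hypotheses (h0 : forall t, t <= d -> h t = C0) (k0 : forall t, t <= d -> k t = C0).
Hypotheses (hc : continuousC h) (kc : continuousC k).
Hypotheses
  (hb : forall t, d < t -> norm1 (h t) <= C * exp (7 / 4 * Im w * t))
  (kb : forall t, d < t -> norm1 (k t) <= C * exp (7 / 4 * Im w * t)).
Hypothesis hd : forall t, d < t -> derivC h t (Cscale (/ (t * (t - d))) (k t)).
Hypothesis kd : forall t, d < t ->
  derivC k t (Csub (Cscale (- 2 / (t * (t - d))) (Cmul Ci (Cmul (Kpot t) (k t))))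
                   (Cmul (Csub (Cscale (2 * (t + q)) (Cmul Ci w)) Lam) (h t))).

(** For a rate [c] the [t^2] part of the adjoint operator on the kernel is [c y (c y - 2 i w)],
    which gives the leading coefficient [y (y - 2 i w / c)]. The choice of [c] puts its second zero
    at [y = d]. *)
Definition laplace_rate : Cx := Cscale (2 / d) (Cmul Ci w).

Definition Eker (y t : R) : Cx := Cexp (Cscale (y * t) laplace_rate).

Definition moment (f : R -> Cx) (n : nat) (y t : R) : Cx :=
  Cscale (t ^ n) (Cmul (Eker y t) (f t)).

Definition transform (n : nat) (y : R) : Cx := Cint (moment h n y).

(** The first factor is the cost of [t ^ n] against [exp (Im w t / 8)], and the 2 comes from
    [norm1_exp]. *)
Definition mom_const (n : nat) : R := INR (fact n) / (Im w / 8) ^ n * (2 * C).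

Lemma growth_const_nonneg : 0 <= C.
Proof.
  specialize (hb (d + 1) ltac:(lra)).
  pose proof (norm1_ge0 (h (d + 1))). pose proof (exp_pos (7 / 4 * Im w * (d + 1))). nra.
Qed.

Lemma mom_const_nonneg n : 0 <= mom_const n.
Proof.
  unfold mom_const; pose proof growth_const_nonneg.
  apply Rmult_le_pos; [|lra].
  left; apply Rdiv_lt_0_compat; [apply INR_fact_lt_0 | apply pow_lt; lra].
Qed.

(** In units of [Im w], the kernel gives rate -2 at [y = d], the growth of [f] costs 7/4 and the
    power of [t] costs 1/8, which leaves -1/8. The decay in [y - d] comes from [t / d >= 1] on the
    support of [f]. *)
Lemma moment_dominated f n y :
  (forall t, t <= d -> f t = C0) ->
  (forall t, d < t -> norm1 (f t) <= C * exp (7 / 4 * Im w * t)) ->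
  d <= y ->
  dominatedC (mom_const n * exp (- 2 * Im w * (y - d))) (Im w / 8) (moment f n y).
Proof.
  intros f0 fb Hy t Ht.
  destruct (Rle_or_lt t d) as [Htd | Htd].
  { unfold moment; rewrite f0 by exact Htd.
    replace (Cscale _ _) with C0 by (apply Cx_eq; simpl; ring).
    unfold norm1; simpl; rewrite Rabs_R0, Rplus_0_l.
    apply Rmult_le_pos; [apply Rmult_le_pos; [apply mom_const_nonneg|]|]; left; apply exp_pos. }
  unfold moment; rewrite norm1_scale, Rabs_pos_eq by now apply pow_le.
  assert (HE : norm1 (Eker y t)
     <= 2 * (exp (- 2 * Im w * t) * exp (- 2 * Im w * (y - d)))).
  { eapply Rle_trans; [apply norm1_exp|].
    apply Rmult_le_compat_l; [lra|]. rewrite <- exp_plus.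
    assert (Hle : Re (Cscale (y * t) laplace_rate)
      <= - 2 * Im w * t + - 2 * Im w * (y - d)).
    { simpl. replace (y * t * (2 / d * (0 * Re w - 1 * Im w)))
        with (- 2 * Im w * t + - 2 * Im w * (y - d) * (t / d)) by (field; lra).
      assert (1 <= t / d).
      { apply (Rmult_le_reg_r d); [lra|].
        unfold Rdiv; rewrite Rmult_assoc, Rinv_l; lra. }
      assert (0 <= Im w * (y - d)) by nra. nra. }
    destruct Hle as [Hl | Hl]; [left; now apply exp_increasing | rewrite Hl; lra]. }
  pose proof (norm1_mul_le _ _ _ _ HE (fb t Htd)) as H1.
  pose proof (pow_le_exp n (Im w / 8) t ltac:(lra) Ht) as H2.
  unfold mom_const.
  replace (INR (fact n) / (Im w / 8) ^ n * (2 * C) * exp (- 2 * Im w * (y - d))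
           * exp (- (Im w / 8) * t))
    with (INR (fact n) / (Im w / 8) ^ n * exp (Im w / 8 * t) *
          (2 * (exp (- 2 * Im w * t) * exp (- 2 * Im w * (y - d)))
           * (C * exp (7 / 4 * Im w * t)))).
  - apply Rmult_le_compat; auto using norm1_ge0. now apply pow_le.
  - replace (- (Im w / 8) * t)
      with (Im w / 8 * t + (- 2 * Im w * t + 7 / 4 * Im w * t)) by field.
    rewrite !exp_plus; ring.
Qed.

Lemma Eker_deriv_t y t : derivC (Eker y) t (Cmul (Cscale y laplace_rate) (Eker y t)).
Proof.
  apply (derivC_exp (fun t => Cscale (y * t) laplace_rate)).
  eapply derivC_eq.
  - apply (derivC_scale (fun t => y * t)).
    + apply is_derive_Reals; auto_derive; [exact I | reflexivity].
    + apply derivC_const.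
  - apply Cx_eq; simpl; ring.
Qed.

Lemma Eker_deriv_y y t : derivC (fun y => Eker y t) y (Cmul (Cscale t laplace_rate) (Eker y t)).
Proof.
  apply (derivC_exp (fun y => Cscale (y * t) laplace_rate)).
  eapply derivC_eq.
  - apply (derivC_scale (fun y => y * t)).
    + apply is_derive_Reals; auto_derive; [exact I | reflexivity].
    + apply derivC_const.
  - apply Cx_eq; simpl; ring.
Qed.

Lemma continuousC_deriv f f' : (forall t, derivC f t (f' t)) -> continuousC f.
Proof.
  intros H t; destruct (H t) as [H1 H2].
  apply is_derive_Reals in H1; apply is_derive_Reals in H2.
  split; apply (ex_derive_continuous (V := R_NormedModule)); eexists; eassumption.
Qed.

Lemma moment_continuous f n y : continuousC f -> continuousC (moment f n y).
Proof.
  intros Hf t.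
  destruct (continuousC_mul _ _ (continuousC_deriv _ _ (Eker_deriv_t y)) Hf t) as [H1 H2].
  split.
  - exact (cont_pow_mult n _ t H1).
  - exact (cont_pow_mult n _ t H2).
Qed.

Lemma moment_tame n y : d <= y -> tame (Im w / 8) (moment h n y).
Proof.
  intros Hy; split; [now apply moment_continuous|].
  eexists; now apply moment_dominated.
Qed.

Lemma moment_deriv_y f n y t :
  derivC (fun y => moment f n y t) y (Cmul laplace_rate (moment f (S n) y t)).
Proof.
  eapply derivC_eq.
  - apply (derivC_scale (fun _ => t ^ n)); [apply derivable_pt_lim_const|].
    apply derivC_mul; [apply Eker_deriv_y | apply derivC_const].
  - unfold moment; apply Cx_eq; simpl; ring.
Qed.

Lemma exp_rate_le1 y : d <= y -> exp (- 2 * Im w * (y - d)) <= 1.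
Proof.
  intros Hy; apply Rle_trans with (exp 0); [|rewrite exp_0; lra].
  destruct (Req_dec y d) as [-> | Hn]; [right; f_equal; ring|].
  left; apply exp_increasing. assert (0 < Im w * (y - d)) by nra. lra.
Qed.

Lemma transform_deriv n y : d < y ->
  derivC (transform n) y (Cmul laplace_rate (transform (S n) y)).
Proof.
  intros Hy.
  pose proof (norm1_ge0 laplace_rate) as Hr.
  set (r := norm1 laplace_rate) in *.
  assert (Hdom : forall j x, d < x -> dominatedC (mom_const j) (Im w / 8) (moment h j x)).
  { intros j x Hx t Ht. eapply Rle_trans; [apply moment_dominated; auto; lra|].
    apply Rmult_le_compat_r; [left; apply exp_pos|].
    pose proof (exp_rate_le1 x ltac:(lra)); pose proof (mom_const_nonneg j). nra. }
  assert (Hweak : forall A B f, A <= B -> dominatedC A (Im w / 8) f ->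
                                dominatedC B (Im w / 8) f).
  { intros A B f HAB Hf t Ht; eapply Rle_trans; [now apply Hf|].
    apply Rmult_le_compat_r; [left; apply exp_pos | exact HAB]. }
  pose proof (mom_const_nonneg n) as M0. pose proof (mom_const_nonneg (S n)) as M1.
  pose proof (mom_const_nonneg (S (S n))) as M2.
  assert (R1 : 0 <= r * mom_const (S n)) by now apply Rmult_le_pos.
  assert (R2 : 0 <= r * (r * mom_const (S (S n)))).
  { apply Rmult_le_pos; auto; now apply Rmult_le_pos. }
  (* The Leibniz rule takes one constant for the integrand and its two derivatives, uniformly in
     [y > d]; the decay in [y] is dropped for this purpose. *)
  set (B := mom_const n + r * mom_const (S n) + r * (r * mom_const (S (S n)))).
  unfold transform.
  rewrite <- (Cint_const_mul (Im w / 8)) by (lra || (apply moment_tame; lra)).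
  apply (Cint_leibniz (fun y => moment h n y)
           (fun y t => Cmul laplace_rate (moment h (S n) y t))
           (fun y t => Cmul laplace_rate (Cmul laplace_rate (moment h (S (S n)) y t)))
           y d B (Im w / 8)); auto; try lra.
  - intros x t _; apply moment_deriv_y.
  - intros x t _. eapply derivC_eq.
    + apply derivC_mul; [apply derivC_const | apply moment_deriv_y].
    + apply Cx_eq; simpl; ring.
  - intros x _; now apply moment_continuous.
  - apply continuousC_mul; [apply continuousC_const | now apply moment_continuous].
  - intros x Hx; apply (Hweak (mom_const n)); [unfold B; lra | now apply Hdom].
  - apply (Hweak (r * mom_const (S n))); [unfold B; lra|].
    apply dominatedC_const_mul; now apply Hdom.
  - intros x Hx; apply (Hweak (r * (r * mom_const (S (S n))))); [unfold B; lra|].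
    do 2 apply dominatedC_const_mul; now apply Hdom.
Qed.

Lemma transform_bound n y : d <= y ->
  norm1 (transform n y) <= 16 / Im w * mom_const n * exp (- 2 * Im w * (y - d)).
Proof.
  intros Hy.
  eapply Rle_trans; [apply (Cint_bound (mom_const n * exp (- 2 * Im w * (y - d))) (Im w / 8))|].
  - lra.
  - now apply moment_continuous.
  - now apply moment_dominated.
  - right; field; lra.
Qed.

(* Green's formula: the boundary term is
   [E (- D h' + (D c y - 2 i K) h)] with [D = t (t - d)] and [E = exp (c y t)],
   and its derivative is the dual operator in [y] applied to [E], times [h]. *)
Lemma transform_ode y : d < y ->
  Cadd (Cadd (Cscale (y * (y - d)) (Cmul laplace_rate (Cmul laplace_rate (transform 2 y))))
             (Cmul (dual_coef1 d q w y) (Cmul laplace_rate (transform 1 y))))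
       (Cmul (dual_coef0 d q am w Lam y) (transform 0 y)) = C0.
Proof.
  intros Hy.
  set (c := laplace_rate).
  set (z2 := Cscale (y * (y - d)) (Cmul c c)).
  set (z1 := Cmul (dual_coef1 d q w y) c).
  set (z0 := dual_coef0 d q am w Lam y).
  transitivity (Cadd (Cadd (Cmul z2 (transform 2 y)) (Cmul z1 (transform 1 y)))
                     (Cmul z0 (transform 0 y))).
  { unfold z2, z1, z0; apply Cx_eq; cbn [Re Im Cadd Cmul Cscale]; ring. }
  assert (Hk8 : 0 < Im w / 8) by lra.
  assert (T : forall n, tame (Im w / 8) (moment h n y)) by (intros; apply moment_tame; lra).
  unfold transform.
  rewrite <- !(Cint_const_mul (Im w / 8)) by auto.
  rewrite <- !(Cint_add (Im w / 8)) by auto using tame_add, tame_const_mul.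
  (* These are the coefficients of [D c y - 2 i K] sorted by powers of [t]. As a combination of
     moments, the boundary term inherits continuity and domination. *)
  set (b2 := Csub (Cscale y c) (Cscale 2 (Cmul Ci w))).
  set (b1 := Csub (Cscale (- d * y) c) (Cscale (4 * q) (Cmul Ci w))).
  set (b0 := Cscale (-2) (Cmul Ci (Kq d q am w))).
  set (B := fun t => Cadd (Cadd (Cadd (Cmul b2 (moment h 2 y t)) (Cmul b1 (moment h 1 y t)))
                          (Cmul b0 (moment h 0 y t))) (Cmul (RtoC (-1)) (moment k 0 y t))).
  assert (TB : tame (Im w / 8) B).
  { apply tame_add; [apply tame_add; [apply tame_add|]|]; apply tame_const_mul; auto.
    split; [now apply moment_continuous | eexists; apply moment_dominated; auto; lra]. }
  assert (mom0 : forall f n t, f t = C0 -> moment f n y t = C0).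
  { intros f n t Hf; unfold moment; rewrite Hf; apply Cx_eq; simpl; ring. }
  destruct TB as [CB (CBd & DB)].
  apply (Cint_derivative_zero _ B d CBd (Im w / 8)); auto; try lra.
  - refine (proj1 (_ : tame (Im w / 8) _)).
    apply tame_add; [apply tame_add|]; apply tame_const_mul; auto.
  - intros t Ht; rewrite !mom0 by auto; apply Cx_eq; simpl; ring.
  - intros t Ht; unfold B; rewrite !mom0 by auto; apply Cx_eq; simpl; ring.
  - intros t Ht.
    (* In this factored form [hd] and [kd] are each applied once, and the second derivative of [h]
       enters only through [k]. *)
    assert (HB : forall x, B x = Cmul (Eker y x)
       (Cadd (Cmul (Csub (Cscale (x * (x - d) * y) c) (Cscale 2 (Cmul Ci (Kpot x)))) (h x))
             (Copp (k x)))).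
    { intros x; unfold B, moment, b2, b1, b0, Kq, Kpot; generalize (Eker y x), c; intros Ex cc.
      apply Cx_eq; cbn [Re Im Cadd Cmul Cscale Csub Copp RtoC Ci]; simpl pow; ring. }
    enough (HD : derivC (fun x => Cmul (Eker y x)
       (Cadd (Cmul (Csub (Cscale (x * (x - d) * y) c) (Cscale 2 (Cmul Ci (Kpot x)))) (h x))
             (Copp (k x)))) t
       (Cadd (Cadd (Cmul z2 (moment h 2 y t)) (Cmul z1 (moment h 1 y t)))
             (Cmul z0 (moment h 0 y t)))).
    { destruct HD as [H1 H2]; split.
      - apply is_derive_Reals; apply is_derive_Reals in H1.
        eapply is_derive_ext; [|exact H1]. intros x; now rewrite (HB x).
      - apply is_derive_Reals; apply is_derive_Reals in H2.
        eapply is_derive_ext; [|exact H2]. intros x; now rewrite (HB x). }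
    eapply derivC_eq.
    + apply derivC_mul; [apply Eker_deriv_t|].
      apply derivC_add; [|apply derivC_opp, kd, Ht].
      apply derivC_mul; [|apply hd, Ht].
      apply derivC_add.
      * apply (derivC_scale (fun x => x * (x - d) * y)); [|apply derivC_const].
        apply is_derive_Reals; auto_derive; [exact I | reflexivity].
      * apply derivC_opp.
        apply (derivC_scale (fun _ => 2)); [apply derivable_pt_lim_const|].
        apply derivC_mul; [apply derivC_const|].
        apply derivC_add; [|apply derivC_opp, derivC_const].
        apply (derivC_scale (fun x => (x + q) ^ 2 + q * (q + d))); [|apply derivC_const].
        apply is_derive_Reals; auto_derive; [exact I | reflexivity].
    + unfold moment, z2, z1, z0, dual_coef1, dual_coef0, Kq, Kpot.
      fold c.
      assert (Ec : c = Cscale (2 / d) (Cmul Ci w)) by reflexivity.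
      generalize (Eker y t), (h t), (k t); intros Ex hh kk.
      match goal with |- Cadd (Cmul (Cmul ?u Ex) ?X) (Cmul Ex ?X') = _ =>
        transitivity (Cmul Ex (Cadd (Cmul u X) X'));
          [generalize u, X, X'; intros; apply Cx_eq; cbn [Re Im Cadd Cmul]; ring|] end.
      match goal with |- _ = Cadd (Cadd (Cmul ?e2 _) (Cmul ?e1 _)) (Cmul ?e0 _) =>
        transitivity (Cmul Ex (Cmul (Cadd (Cadd (Cscale (t ^ 2) e2) (Cscale t e1)) e0) hh));
          [|generalize e2, e1, e0; intros; apply Cx_eq; cbn [Re Im Cadd Cmul Cscale];
            simpl pow; ring] end.
      f_equal. rewrite Ec. clear - Hd Ht.
      apply Cx_eq; cbn [Re Im Cadd Cmul Cscale Csub Copp RtoC Ci C0]; simpl pow; field; lra.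
Qed.


Lemma laplace_rate_mul_eq0 z : Cmul laplace_rate z = C0 -> z = C0.
Proof.
  intros H.
  assert (H1 := f_equal Re H); assert (H2 := f_equal Im H); simpl in H1, H2.
  assert (Hn : 0 < Re w ^ 2 + Im w ^ 2).
  { pose proof (pow2_ge_0 (Re w)); pose proof (pow_lt _ 2 Hw); lra. }
  assert (E1 : Re w * Re z - Im w * Im z = 0).
  { apply (Rmult_eq_reg_l (2 / d)); [|apply Rgt_not_eq, Rdiv_lt_0_compat; lra].
    rewrite Rmult_0_r, <- H2; ring. }
  assert (E2 : Re w * Im z + Im w * Re z = 0).
  { apply (Rmult_eq_reg_l (- (2 / d)));
      [|apply Rlt_not_eq, Ropp_lt_gt_0_contravar, Rdiv_lt_0_compat; lra].
    rewrite Rmult_0_r, <- H1; ring. }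
  apply Cx_eq; simpl; apply (Rmult_eq_reg_l (Re w ^ 2 + Im w ^ 2)); try lra.
  - replace (_ * Re z) with (Re w * (Re w * Re z - Im w * Im z)
      + Im w * (Re w * Im z + Im w * Re z)) by ring.
    rewrite E1, E2; ring.
  - replace (_ * Im z) with (Re w * (Re w * Im z + Im w * Re z)
      - Im w * (Re w * Re z - Im w * Im z)) by ring.
    rewrite E1, E2; ring.
Qed.

(** The energy argument settles [n = 0]. A function that is zero on the open half-line has zero
    derivative there, and this derivative is the next transform times the nonzero number
    [laplace_rate]. *)
Lemma transform_zero n y : d < y -> transform n y = C0.
Proof.
  revert y; induction n as [|n IH]; intros y Hy.
  - set (r := norm1 laplace_rate).
    assert (Hr : 0 <= r) by apply norm1_ge0.
    set (D0 := 16 / Im w * mom_const 0). set (D1 := r * (16 / Im w * mom_const 1)).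
    assert (H16 : 0 < 16 / Im w) by (apply Rdiv_lt_0_compat; lra).
    assert (HD0 : 0 <= D0) by (apply Rmult_le_pos; [lra | apply mom_const_nonneg]).
    assert (HD1 : 0 <= D1).
    { apply Rmult_le_pos; [exact Hr|]. apply Rmult_le_pos; [lra | apply mom_const_nonneg]. }
    apply (dual_vanishes d q am w Lam Hd Hq Hw HLam (transform 0)
             (fun y => Cmul laplace_rate (transform 1 y))
             (fun y => Cmul laplace_rate (Cmul laplace_rate (transform 2 y))) (D0 + D1));
      auto; try lra.
    + intros x Hx; now apply transform_deriv.
    + intros x Hx; eapply derivC_eq.
      * apply derivC_mul; [apply derivC_const | now apply transform_deriv].
      * apply Cx_eq; simpl; ring.
    + apply transform_ode.
    + intros x Hx; eapply Rle_trans; [apply transform_bound; lra|]; fold D0.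
      apply Rmult_le_compat_r; [left; apply exp_pos | lra].
    + intros x Hx; eapply Rle_trans.
      { apply norm1_mul_le; [apply Rle_refl | apply transform_bound; lra]. }
      fold r; rewrite <- Rmult_assoc; fold D1.
      apply Rmult_le_compat_r; [left; apply exp_pos | lra].
  - apply laplace_rate_mul_eq0.
    pose proof (transform_deriv n y Hy) as [H1 H2].
    assert (Hloc : locally y (fun x => d < x)) by (apply (open_gt d); exact Hy).
    assert (Hz : forall p : Cx -> R, p C0 = 0 ->
       derivable_pt_lim (fun x => p (transform n x)) y 0).
    { intros p Hp; apply is_derive_Reals.
      apply (is_derive_ext_loc (fun _ => 0)); [|apply (is_derive_const (V := R_NormedModule))].
      apply (filter_imp (fun x => d < x)); [|exact Hloc].
      intros x Hx; rewrite (IH x Hx), Hp; reflexivity. }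
    apply Cx_eq; simpl.
    + exact (uniqueness_limite _ _ _ _ H1 (Hz Re eq_refl)).
    + exact (uniqueness_limite _ _ _ _ H2 (Hz Im eq_refl)).
Qed.

(** The equation enters as a first order system for [h] and [k = t (t - d) h'], so that only the
    continuity of these two across [t = d] is involved. Vanishing of all the transforms at one [y]
    says that the kernel times [h] has null moments, componentwise. *)
Theorem bounded_growth_solution_zero t : d < t -> h t = C0.
Proof.
  intros Ht.
  (* Any point beyond [d] serves; here the kernel is [exp (4 i w t)]. *)
  set (y := 2 * d).
  assert (Hm := fun n => transform_zero n y ltac:(unfold y; lra)).
  assert (HE : Cmul (Eker y t) (h t) = C0).
  { pose proof (moment_continuous h 0 y hc) as Hc.
    pose proof (moment_dominated h 0 y h0 hb ltac:(unfold y; lra)) as Hdom.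
    assert (M0 : forall x, moment h 0 y x = Cmul (Eker y x) (h x)).
    { intros x; unfold moment; apply Cx_eq; simpl; ring. }
    rewrite <- M0.
    apply Cx_eq; simpl Re; simpl Im.
    - apply (null_moments_zero _ (Im w / 8) (fun x => Re (moment h 0 y x)) t
               ltac:(lra) (fun x => proj1 (Hc x)) (dominatedC_Re _ _ _ Hdom)); [|lra].
      intros n; specialize (Hm n); apply (f_equal Re) in Hm.
      change (halfline_int (fun t => Re (moment h n y t)) = 0) in Hm.
      rewrite <- Hm; apply halfline_int_ext; intros x _; unfold moment; simpl; ring.
    - apply (null_moments_zero _ (Im w / 8) (fun x => Im (moment h 0 y x)) t
               ltac:(lra) (fun x => proj2 (Hc x)) (dominatedC_Im _ _ _ Hdom)); [|lra].
      intros n; specialize (Hm n); apply (f_equal Im) in Hm.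
      change (halfline_int (fun t => Im (moment h n y t)) = 0) in Hm.
      rewrite <- Hm; apply halfline_int_ext; intros x _; unfold moment; simpl; ring. }
  apply (Cexp_mul_eq0 _ _ HE).
Qed.

End Transform.

(** * The angular equation *)

Lemma continuous3_meridian f t : continuous3 f -> continuous (fun t => f (sin t) 0 (cos t)) t.
Proof.
  intros Hf; apply continuity_pt_filterlim; intros eps He.
  destruct (Hf (sin t) 0 (cos t) eps He) as (del & Hdel & H).
  destruct (continuity_sin t del Hdel) as (d1 & Hd1 & H1).
  destruct (continuity_cos t del Hdel) as (d2 & Hd2 & H2).
  exists (Rmin d1 d2); split; [now apply Rmin_pos|].
  intros x [Dx Hx]; simpl in *; unfold Rdist in *.
  apply H.
  - apply H1; split; [exact Dx|]. eapply Rlt_le_trans; [exact Hx | apply Rmin_l].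
  - rewrite Rminus_diag, Rabs_R0; exact Hdel.
  - apply H2; split; [exact Dx|]. eapply Rlt_le_trans; [exact Hx | apply Rmin_r].
Qed.

(** Along the meridian of longitude zero, a smooth extension to space becomes a C^1 function of the
    angle on the whole line. This is the source of the bounds on [S] and its derivative up to the
    poles. *)
Lemma smooth3_meridian f : smooth3 f ->
  exists f1 : R -> R, (forall t, continuous f1 t) /\
    forall t, derivable_pt_lim (fun t => f (sin t) 0 (cos t)) t (f1 t).
Proof.
  intros (D & <- & Dc & Dd).
  exists (fun t => D 1%nat 0%nat 0%nat (sin t) 0 (cos t) * cos t
                   + D 0%nat 0%nat 1%nat (sin t) 0 (cos t) * - sin t).
  split.
  - intros t; apply (continuous_plus (V := R_NormedModule)); apply cont_mult;
      try (apply (continuous3_meridian (D _ _ _)), Dc); cont_elem.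
  - intros t.
    apply (derivable_pt_lim_comp_2d (fun x z => D 0%nat 0%nat 0%nat x 0 z) sin cos);
      [|apply derivable_pt_lim_sin | apply derivable_pt_lim_cos].
    apply filterdiff_differentiable_pt_lim.
    apply (is_derive_filterdiff (fun x z => D 0%nat 0%nat 0%nat x 0 z) (sin t) (cos t)
             (fun x z => D 1%nat 0%nat 0%nat x 0 z)).
    + apply filter_forall; intros [x z]; apply is_derive_Reals, Dd.
    + apply is_derive_Reals, Dd.
    + intros P [eps HP].
      destruct (Dc 1%nat 0%nat 0%nat (sin t) 0 (cos t) eps (cond_pos eps)) as (del & Hdel & H).
      exists (mkposreal del Hdel); intros [x z] [Hx Hz]; apply HP.
      apply H; [exact Hx | rewrite Rminus_diag, Rabs_R0; exact Hdel | exact Hz].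
Qed.

(** The flux [Im (conj w sin S' conj S)] vanishes at both poles, since [sin] does and [S], [S'] stay
    bounded. The terms in [m^2], [a^2 w^2] and [|S'|^2] make its derivative nonpositive; if
    [Im (conj w lam)] were positive, the derivative would be strictly negative wherever [S] is not
    zero. *)
Lemma angular_eigenvalue_sign a w m lam :
  0 < Im w -> angular_eigenvalue a w m lam -> Re w * Im lam - Im w * Re lam <= 0.
Proof.
  intros Hw (S & (th0 & Hth0 & HS0) & S1 & T1 & HS1 & HT1 & Hode & F & [HF1 HF2] & HF).
  apply Rnot_lt_le; intros Hpos.
  destruct (smooth3_meridian _ HF1) as (f1 & Cf1 & Df1).
  destruct (smooth3_meridian _ HF2) as (f2 & Cf2 & Df2).
  assert (HSF : forall t, 0 < t < PI -> F (sin t) 0 (cos t) = S t).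
  { intros t Ht; specialize (HF t 0 Ht); rewrite cos_0, sin_0, Rmult_1_r, Rmult_0_r in HF.
    rewrite HF; apply Cx_eq; simpl;
      rewrite ?Rmult_0_r, ?Rmult_0_l, ?exp_0, ?cos_0, ?sin_0; ring. }
  assert (Hloc : forall t, 0 < t < PI -> locally t (fun x => 0 < x < PI)).
  { intros t Ht; apply (filter_and (fun x => 0 < x) (fun x => x < PI));
      [apply (open_gt 0) | apply (open_lt PI)]; apply Ht. }
  assert (HS1F : forall t, 0 < t < PI -> Re (S1 t) = f1 t /\ Im (S1 t) = f2 t).
  { intros t Ht; destruct (HS1 t Ht) as [E1 E2]; split.
    - apply (uniqueness_limite _ _ _ _ E1), is_derive_Reals.
      apply (is_derive_ext_loc (fun t => Re (F (sin t) 0 (cos t)))).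
      + apply (filter_imp (fun x => 0 < x < PI)); [|now apply Hloc].
        intros x Hx; now rewrite HSF.
      + apply is_derive_Reals, Df1.
    - apply (uniqueness_limite _ _ _ _ E2), is_derive_Reals.
      apply (is_derive_ext_loc (fun t => Im (F (sin t) 0 (cos t)))).
      + apply (filter_imp (fun x => 0 < x < PI)); [|now apply Hloc].
        intros x Hx; now rewrite HSF.
      + apply is_derive_Reals, Df2. }
  assert (Hbd : forall f : R -> R, (forall t, continuous f t) ->
     exists A, forall t, 0 < t < PI -> Rabs (f t) <= A).
  { intros f Hf.
    destruct (bounded_continuity (K := R_AbsRing) (V := R_NormedModule) f 0 PI) as [A HA].
    { intros x _; apply Hf. }
    exists A; intros t Ht; left; apply (HA t); lra. }
  assert (HSb : exists A, forall t, 0 < t < PI -> norm1 (S t) <= A /\ norm1 (S1 t) <= A).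
  { destruct (Hbd f1 Cf1) as [A1 H1]; destruct (Hbd f2 Cf2) as [A2 H2].
    destruct (Hbd (fun t => Re (F (sin t) 0 (cos t)))) as [A3 H3].
    { intros t; apply (ex_derive_continuous (V := R_NormedModule)); eexists;
        apply is_derive_Reals, Df1. }
    destruct (Hbd (fun t => Im (F (sin t) 0 (cos t)))) as [A4 H4].
    { intros t; apply (ex_derive_continuous (V := R_NormedModule)); eexists;
        apply is_derive_Reals, Df2. }
    exists (Rmax (A1 + A2) (A3 + A4)); intros t Ht.
    specialize (H1 t Ht); specialize (H2 t Ht); specialize (H3 t Ht); specialize (H4 t Ht).
    rewrite HSF in H3, H4 by exact Ht.
    destruct (HS1F t Ht) as [E1 E2]. unfold norm1; rewrite E1, E2.
    pose proof (Rmax_l (A1 + A2) (A3 + A4)); pose proof (Rmax_r (A1 + A2) (A3 + A4)). lra. }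
  destruct HSb as [A HA].
  assert (HA0 : 0 <= A).
  { destruct (HA th0 Hth0); pose proof (norm1_ge0 (S th0)); lra. }
  set (B := fun t => Re w * (Im (Cscale (sin t) (S1 t)) * Re (S t)
                             - Re (Cscale (sin t) (S1 t)) * Im (S t))
                     - Im w * (Re (Cscale (sin t) (S1 t)) * Re (S t)
                               + Im (Cscale (sin t) (S1 t)) * Im (S t))).
  set (B' := fun t => - (sin t *
      ((Im w * (IZR m ^ 2 / sin t ^ 2 + a ^ 2 * (Re w ^ 2 + Im w ^ 2) * cos t ^ 2)
        + (Re w * Im lam - Im w * Re lam)) * (Re (S t) ^ 2 + Im (S t) ^ 2)
       + Im w * (Re (S1 t) ^ 2 + Im (S1 t) ^ 2)))).
  assert (Hsin : forall t, 0 < t < PI -> 0 < sin t) by (intros; apply sin_gt_0; lra).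
  assert (Hcoef : forall t, 0 < t < PI ->
     0 < Im w * (IZR m ^ 2 / sin t ^ 2 + a ^ 2 * (Re w ^ 2 + Im w ^ 2) * cos t ^ 2)
         + (Re w * Im lam - Im w * Re lam)).
  { intros t Ht.
    assert (0 <= IZR m ^ 2 / sin t ^ 2).
    { apply Rdiv_le_0_compat; [apply pow2_ge_0 | apply pow_lt, Hsin, Ht]. }
    assert (0 <= a ^ 2 * (Re w ^ 2 + Im w ^ 2) * cos t ^ 2).
    { apply Rmult_le_pos; [|apply pow2_ge_0]. apply Rmult_le_pos; [apply pow2_ge_0|].
      apply Rplus_le_le_0_compat; apply pow2_ge_0. }
    apply Rplus_le_lt_0_compat; [apply Rmult_le_pos; lra | exact Hpos]. }
  assert (HS2 : forall z : Cx, 0 <= Re z ^ 2 + Im z ^ 2).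
  { intros z; apply Rplus_le_le_0_compat; apply pow2_ge_0. }
  assert (HBt : B' th0 = 0).
  { apply (nonincreasing_null_ends (fun t => 0 < t < PI) B B'); [intros; lra | | | | exact Hth0].
    - intros t Ht.
      destruct (HS1 t Ht) as [DS1 DS2]; destruct (HT1 t Ht) as [DP1 DP2].
      specialize (Hode t Ht); specialize (Hsin t Ht).
      assert (ET : T1 t = Cscale (sin t) (Csub (Cmul (Csub (RtoC (IZR m ^ 2 / sin t ^ 2))
                 (Cscale (a ^ 2 * cos t ^ 2) (Cmul w w))) (S t)) (Cmul lam (S t)))).
      { set (X := Cmul (Csub _ _) _) in Hode |- *; set (Y := Cmul lam (S t)) in *.
        assert (H1 := f_equal Re Hode); assert (H2 := f_equal Im Hode).
        cbn [Re Im Cadd Cscale Copp C0] in H1, H2.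
        apply Cx_eq; cbn [Re Im Cadd Cscale Copp Csub].
        - replace (Re X + - Re Y) with (/ sin t * Re (T1 t)) by lra. field; lra.
        - replace (Im X + - Im Y) with (/ sin t * Im (T1 t)) by lra. field; lra. }
      assert (HD := derivable_pt_lim_minus _ _ _ _ _
        (derivable_pt_lim_scal _ (Re w) _ _ (derivable_pt_lim_minus _ _ _ _ _
          (derivable_pt_lim_mult _ _ _ _ _ DP2 DS1) (derivable_pt_lim_mult _ _ _ _ _ DP1 DS2)))
        (derivable_pt_lim_scal _ (Im w) _ _ (derivable_pt_lim_plus _ _ _ _ _
          (derivable_pt_lim_mult _ _ _ _ _ DP1 DS1) (derivable_pt_lim_mult _ _ _ _ _ DP2 DS2)))).
      match type of HD with derivable_pt_lim _ _ ?l => replace (B' t) with l end.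
      { exact HD. }
      rewrite ET; unfold B'; cbn [Re Im Cadd Cscale Copp Csub Cmul RtoC]. field; lra.
    - intros t Ht; unfold B'.
      assert (0 <= sin t *
        ((Im w * (IZR m ^ 2 / sin t ^ 2 + a ^ 2 * (Re w ^ 2 + Im w ^ 2) * cos t ^ 2)
          + (Re w * Im lam - Im w * Re lam)) * (Re (S t) ^ 2 + Im (S t) ^ 2)
         + Im w * (Re (S1 t) ^ 2 + Im (S1 t) ^ 2))); [|lra].
      apply Rmult_le_pos; [left; now apply Hsin|].
      apply Rplus_le_le_0_compat; apply Rmult_le_pos; auto; left; auto.
    - assert (HBb : forall t, 0 < t < PI -> Rabs (B t) <= sin t * (norm1 w * (A * A))).
      { intros t Ht; destruct (HA t Ht) as [N0 N1].
        replace (B t) with (sin t * Im (Cmul (Cmk (Re w) (- Im w))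
           (Cmul (S1 t) (Cmk (Re (S t)) (- Im (S t)))))) by (unfold B; simpl; ring).
        rewrite Rabs_mult, (Rabs_pos_eq (sin t)) by (left; now apply Hsin).
        apply Rmult_le_compat_l; [left; now apply Hsin|].
        eapply Rle_trans; [apply Im_le_norm1|].
        apply norm1_mul_le; [unfold norm1; simpl; rewrite Rabs_Ropp; lra|].
        apply norm1_mul_le; [exact N1 | unfold norm1 in *; simpl; rewrite Rabs_Ropp; lra]. }
      assert (HD : 0 <= norm1 w * (A * A)).
      { apply Rmult_le_pos; [apply norm1_ge0 | nra]. }
      set (D := norm1 w * (A * A)) in *.
      intros t eps Ht He.
      (* One [e] serves both poles, through the points [e] and [PI - e], because the bound on [B] is
         proportional to [sin]. *)
      assert (Hsmall : exists e, 0 < e /\ e < t /\ e < PI - t /\ e * D < eps).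
      { assert (Hq : 0 < eps / (D + 1)) by (apply Rdiv_lt_0_compat; lra).
        exists (Rmin (eps / (D + 1)) (Rmin (t / 2) ((PI - t) / 2))).
        pose proof (Rmin_l (eps / (D + 1)) (Rmin (t / 2) ((PI - t) / 2))) as H1.
        pose proof (Rmin_r (eps / (D + 1)) (Rmin (t / 2) ((PI - t) / 2))) as H2.
        pose proof (Rmin_l (t / 2) ((PI - t) / 2)).
        pose proof (Rmin_r (t / 2) ((PI - t) / 2)).
        assert (H5 : 0 < Rmin (eps / (D + 1)) (Rmin (t / 2) ((PI - t) / 2))).
        { repeat apply Rmin_pos; lra. }
        set (e := Rmin _ _) in *.
        repeat split; try lra.
        apply (Rmult_le_compat_l (D + 1)) in H1; [|lra].
        replace ((D + 1) * (eps / (D + 1))) with eps in H1 by (field; lra). lra. }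
      destruct Hsmall as (e & E0 & E1 & E2 & E3).
      assert (Hse : 0 < sin e < e) by (split; [apply Hsin; lra | apply sin_lt_x; lra]).
      assert (sin e * D <= e * D) by (apply Rmult_le_compat_r; lra).
      split.
      + exists e; repeat split; try lra. eapply Rle_lt_trans; [apply HBb; lra | lra].
      + exists (PI - e); repeat split; try lra.
        eapply Rle_lt_trans; [apply HBb; lra|].
        rewrite sin_PI_x; lra. }
  assert (HSpos : 0 < Re (S th0) ^ 2 + Im (S th0) ^ 2).
  { destruct (HS2 (S th0)) as [H | H]; [exact H | exfalso; apply HS0].
    apply Cx_eq; simpl; nra. }
  unfold B' in HBt.
  specialize (Hsin th0 Hth0); specialize (Hcoef th0 Hth0).
  pose proof (Rmult_lt_0_compat _ _ Hcoef HSpos) as H1.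
  pose proof (Rmult_le_pos _ _ (Rlt_le _ _ Hw) (HS2 (S1 th0))) as H2.
  pose proof (Rmult_lt_0_compat _ _ Hsin (Rplus_lt_le_0_compat _ _ H1 H2)). lra.
Qed.

(** * The radial equation *)

Lemma continuousC_vanishing_left (f f' : R -> Cx) d :
  (forall t, t <= d -> f t = C0) ->
  (forall t, d < t -> derivC f t (f' t)) ->
  (forall eps, 0 < eps -> exists t0, d < t0 /\ forall t, d < t < t0 -> norm1 (f t) < eps) ->
  continuousC f.
Proof.
  intros H0 Hd Hl t.
  destruct (Rtotal_order t d) as [Ht | [-> | Ht]].
  - assert (Hloc : locally t (fun x => C0 = f x)).
    { apply (filter_imp (fun x => x < d)); [|apply (open_lt d); exact Ht].
      intros x Hx; symmetry; apply H0; lra. }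
    split.
    + apply (continuous_ext_loc _ (fun _ => 0)); [|apply continuous_const].
      apply (filter_imp _ _ (fun x Hx => f_equal Re Hx) Hloc).
    + apply (continuous_ext_loc _ (fun _ => 0)); [|apply continuous_const].
      apply (filter_imp _ _ (fun x Hx => f_equal Im Hx) Hloc).
  - assert (Hn : forall eps, 0 < eps -> exists del, 0 < del /\
        forall x, Rabs (x - d) < del -> norm1 (f x) < eps).
    { intros eps He; destruct (Hl eps He) as (t0 & Ht0 & H).
      exists (t0 - d); split; [lra|]; intros x Hx; apply Rabs_def2 in Hx.
      destruct (Rle_or_lt x d) as [Hxd | Hxd].
      - rewrite H0 by exact Hxd; unfold norm1; simpl; rewrite Rabs_R0; lra.
      - apply H; lra. }
    split; apply continuity_pt_filterlim; intros eps He;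
      destruct (Hn eps He) as (del & Hdel & H); exists del; split; auto;
      intros x [_ Hx]; simpl in *; unfold Rdist in *; rewrite (H0 d (Rle_refl d)); simpl;
      rewrite Rminus_0_r; eapply Rle_lt_trans.
    + apply Re_le_norm1.
    + now apply H.
    + apply Im_le_norm1.
    + now apply H.
  - destruct (Hd t Ht) as [D1 D2]; apply is_derive_Reals in D1; apply is_derive_Reals in D2.
    split; apply (ex_derive_continuous (V := R_NormedModule)); eexists; eassumption.
Qed.

(** On an interval of unit length the mean value theorem finds a point where [u1] is at most [2 B]
    in each component, and [u2] changes it by at most [B2] up to that point. Adding the two
    components doubles the constants. *)
Lemma bounded_derivative (u u1 u2 : R -> Cx) B B2 :
  (forall s, derivC u s (u1 s)) -> (forall s, derivC u1 s (u2 s)) ->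
  (forall s, norm1 (u s) <= B) -> (forall s, norm1 (u2 s) <= B2) ->
  forall s, norm1 (u1 s) <= 4 * B + 2 * B2.
Proof.
  intros D1 D2 HB HB2 s.
  assert (H : forall p : Cx -> R, (forall z, Rabs (p z) <= norm1 z) ->
    (forall s, derivable_pt_lim (fun t => p (u t)) s (p (u1 s))) ->
    (forall s, derivable_pt_lim (fun t => p (u1 t)) s (p (u2 s))) ->
    Rabs (p (u1 s)) <= 2 * B + B2).
  { intros p Hp E1 E2.
    destruct (MVT_cor2 (fun t => p (u t)) (fun t => p (u1 t)) s (s + 1) ltac:(lra)
                (fun c _ => E1 c)) as (z & Hz & Hzi).
    destruct (MVT_cor2 (fun t => p (u1 t)) (fun t => p (u2 t)) s z ltac:(lra)
                (fun c _ => E2 c)) as (v & Hv & Hvi).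
    pose proof (Rle_trans _ _ _ (Hp (u s)) (HB s)) as A1.
    pose proof (Rle_trans _ _ _ (Hp (u (s + 1))) (HB (s + 1))) as A2.
    pose proof (Rle_trans _ _ _ (Hp (u2 v)) (HB2 v)) as A3.
    apply Rabs_le_between in A1; apply Rabs_le_between in A2; apply Rabs_le_between in A3.
    apply Rabs_le; nra. }
  pose proof (H Re Re_le_norm1 (fun s => proj1 (D1 s)) (fun s => proj1 (D2 s))).
  pose proof (H Im Im_le_norm1 (fun s => proj2 (D1 s)) (fun s => proj2 (D2 s))).
  unfold norm1; lra.
Qed.

Section Kerr.

Variables (M a : R).
Hypotheses (HM : 0 < M) (Ha : Rabs a < M).

Notation p := (rplus M a).
Notation q := (rminus M a).
Notation Del := (DeltaK M a).

Lemma kerr_sqrt : 0 < sqrt (M ^ 2 - a ^ 2) <= M /\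
  sqrt (M ^ 2 - a ^ 2) * sqrt (M ^ 2 - a ^ 2) = M ^ 2 - a ^ 2.
Proof.
  assert (H : 0 < M ^ 2 - a ^ 2) by (apply Rabs_def2 in Ha; nra).
  repeat split.
  - now apply sqrt_lt_R0.
  - rewrite <- (sqrt_pow2 M) at 2 by lra. apply sqrt_le_1_alt; nra.
  - apply sqrt_sqrt; lra.
Qed.

Lemma rplus_bounds : M < p <= 2 * M.
Proof. destruct kerr_sqrt; unfold rplus; lra. Qed.

Lemma rminus_nonneg : 0 <= q.
Proof. destruct kerr_sqrt; unfold rminus; lra. Qed.

Lemma rplus_minus_pos : 0 < p - q.
Proof. destruct kerr_sqrt; unfold rplus, rminus; lra. Qed.

Lemma rplus_mul_rminus : q * p = a ^ 2.
Proof. destruct kerr_sqrt; unfold rplus, rminus; nra. Qed.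

Lemma DeltaK_factor r : Del r = (r - q) * (r - p).
Proof.
  pose proof rplus_mul_rminus as H; unfold DeltaK; rewrite <- H; unfold rplus, rminus; ring.
Qed.

Lemma DeltaK_pos r : p < r -> 0 < Del r.
Proof.
  intros Hr; rewrite DeltaK_factor; pose proof rplus_minus_pos.
  apply Rmult_lt_0_compat; lra.
Qed.

Variables (w : Cx) (m : Z) (lam : Cx).
Hypothesis Hw : 0 < Im w.

Lemma Vpot_bounded : exists B, forall r, p < r ->
  norm1 (Csub (Cmul w w) (Vpot M a w m lam r)) <= B.
Proof.
  set (X := norm1 (Cadd lam (Cscale (a ^ 2) (Cmul w w)))).
  exists (norm1 (Cmul w w)
     + (Rabs (4 * M * a * IZR m) * norm1 w * (/ M * / M ^ 2)
        + a ^ 2 * IZR m ^ 2 * (/ M ^ 2 * / M ^ 2) + X * / M ^ 2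
        + (a ^ 2 * (/ M ^ 2 * / M ^ 2) + 2 * M * (/ M * / M ^ 2)))).
  intros r Hr. pose proof rplus_bounds as Hp. pose proof (DeltaK_pos r Hr) as HD.
  eapply Rle_trans; [apply norm1_sub|]. apply Rplus_le_compat_l.
  (* Every term of [V] is a product of [j], [r * j] and [Del r * j], which are bounded by [/ M ^ 2],
     [/ M] and 1. *)
  set (j := / (r ^ 2 + a ^ 2)).
  assert (Hv : M ^ 2 < r ^ 2 + a ^ 2) by nra.
  assert (HM2 : 0 < M ^ 2) by (apply pow_lt; lra).
  assert (Hj : 0 < j) by (apply Rinv_0_lt_compat; lra).
  assert (Hj1 : j <= / M ^ 2) by (apply Rinv_le_contravar; lra).
  assert (Hvj : (r ^ 2 + a ^ 2) * j = 1) by (unfold j; field; lra).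
  assert (Hrj : r * j <= / M).
  { apply (Rmult_le_reg_l M); [lra|]. rewrite Rinv_r by lra. rewrite <- Hvj.
    rewrite <- Rmult_assoc; apply Rmult_le_compat_r; [lra|]. nra. }
  assert (HDv : Del r <= r ^ 2 + a ^ 2) by (unfold DeltaK; nra).
  assert (HDj : Del r * j <= 1).
  { rewrite <- Hvj; apply Rmult_le_compat_r; lra. }
  assert (HDj0 : 0 <= Del r * j) by (apply Rmult_le_pos; lra).
  assert (Hrj0 : 0 <= r * j) by (apply Rmult_le_pos; lra).
  assert (HX : 0 <= X) by apply norm1_ge0.
  assert (Hjj : j * j <= / M ^ 2 * / M ^ 2) by (apply Rmult_le_compat; lra).
  assert (Hrjj : (r * j) * j <= / M * / M ^ 2) by (apply Rmult_le_compat; lra).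
  unfold Vpot; cbv zeta. eapply Rle_trans; [apply norm1_add|].
  apply Rplus_le_compat.
  - rewrite norm1_scale.
    replace (/ (r ^ 2 + a ^ 2) ^ 2) with (j * j) by (unfold j; field; lra).
    rewrite (Rabs_pos_eq (j * j)) by (apply Rmult_le_pos; lra).
    transitivity (j * j * (Rabs (4 * M * a * IZR m) * r * norm1 w + a ^ 2 * IZR m ^ 2 + Del r * X)).
    + apply Rmult_le_compat_l; [apply Rmult_le_pos; lra|].
      eapply Rle_trans; [apply norm1_add|]. apply Rplus_le_compat.
      * eapply Rle_trans; [apply norm1_sub|]. apply Rplus_le_compat.
        -- rewrite norm1_scale. right.
           replace (4 * M * r * a * IZR m) with (4 * M * a * IZR m * r) by ring.
           now rewrite Rabs_mult, (Rabs_pos_eq r) by lra.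
        -- rewrite norm1_RtoC, Rabs_pos_eq; [lra|].
           apply Rmult_le_pos; apply pow2_ge_0.
      * rewrite norm1_scale, Rabs_pos_eq by lra. unfold X; lra.
    + replace (j * j * (Rabs (4 * M * a * IZR m) * r * norm1 w + a ^ 2 * IZR m ^ 2 + Del r * X))
        with (Rabs (4 * M * a * IZR m) * norm1 w * (r * j * j)
              + a ^ 2 * IZR m ^ 2 * (j * j) + X * ((Del r * j) * j)) by ring.
      apply Rplus_le_compat; [apply Rplus_le_compat|]; apply Rmult_le_compat_l; auto.
      * apply Rmult_le_pos; [apply Rabs_pos | apply norm1_ge0].
      * apply Rmult_le_pos; apply pow2_ge_0.
      * rewrite <- (Rmult_1_l (/ M ^ 2)); apply Rmult_le_compat; lra.
  - rewrite norm1_RtoC.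
    set (Y := a ^ 2 * Del r + 2 * M * r * (r ^ 2 - a ^ 2)).
    replace (Del r / (r ^ 2 + a ^ 2) ^ 4 * Y) with ((Del r * j) * (Y * (j * (j * j))))
      by (unfold j; field; lra).
    assert (HY : Rabs Y <= (a ^ 2 + 2 * M * r) * (r ^ 2 + a ^ 2)).
    { assert (0 <= M * r) by nra.
      assert (0 <= (M * r) * r ^ 2) by (apply Rmult_le_pos; [lra | apply pow2_ge_0]).
      assert (0 <= (M * r) * a ^ 2) by (apply Rmult_le_pos; [lra | apply pow2_ge_0]).
      assert (0 <= a ^ 2 * Del r <= a ^ 2 * (r ^ 2 + a ^ 2)).
      { split; [apply Rmult_le_pos | apply Rmult_le_compat_l]; try apply pow2_ge_0; lra. }
      apply Rabs_le; unfold Y; split; lra. }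
    rewrite Rabs_mult, (Rabs_pos_eq (Del r * j)) by lra.
    rewrite <- (Rmult_1_l (_ + _)). apply Rmult_le_compat; [lra | apply Rabs_pos | lra |].
    rewrite Rabs_mult, (Rabs_pos_eq (j * (j * j))) by (repeat apply Rmult_le_pos; lra).
    transitivity ((a ^ 2 + 2 * M * r) * (r ^ 2 + a ^ 2) * (j * (j * j))).
    + apply Rmult_le_compat_r; [repeat apply Rmult_le_pos; lra | exact HY].
    + replace ((a ^ 2 + 2 * M * r) * (r ^ 2 + a ^ 2) * (j * (j * j)))
        with ((a ^ 2 * (j * j) + 2 * M * (r * j * j)) * ((r ^ 2 + a ^ 2) * j)) by ring.
      rewrite Hvj, Rmult_1_r. apply Rplus_le_compat; apply Rmult_le_compat_l; auto.
      * apply pow2_ge_0.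
      * lra.
Qed.

Variable rs : R -> R.
Hypotheses
  (Hrs_deriv : forall r, p < r -> derivable_pt_lim rs r ((r ^ 2 + a ^ 2) / Del r))
  (Hrs_incr : forall r1 r2, p < r1 -> r1 < r2 -> rs r1 < rs r2)
  (Hrs_onto : forall s, exists r, p < r /\ rs r = s).

(** The slope is at most 3/2 exactly when [r^2 + a^2 >= 6 M r], which holds beyond [6 M]. Any slope
    below 2 would leave room against the decay [exp (- 2 Im w t)] of the kernel. *)
Lemma rs_growth : exists A, forall r, p < r -> rs r <= A + 3 / 2 * r.
Proof.
  pose proof rplus_bounds as Hp.
  exists (Rabs (rs (6 * M))); intros r Hr.
  pose proof (Rle_abs (rs (6 * M))) as HA.
  destruct (Rtotal_order r (6 * M)) as [H | [-> | H]]; [| lra |].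
  - specialize (Hrs_incr r (6 * M) Hr H); lra.
  - destruct (MVT_cor2 rs (fun r => (r ^ 2 + a ^ 2) / Del r) (6 * M) r H) as (z & Hz & Hz').
    { intros c Hc; apply Hrs_deriv; lra. }
    assert (Hq : (z ^ 2 + a ^ 2) / Del z <= 3 / 2).
    { pose proof (DeltaK_pos z ltac:(lra)) as HD.
      apply (Rmult_le_reg_r (Del z)); [exact HD|].
      unfold Rdiv at 1; rewrite Rmult_assoc, Rinv_l, Rmult_1_r by lra.
      unfold DeltaK; nra. }
    apply (Rmult_le_compat_r (r - 6 * M)) in Hq; lra.
Qed.

Lemma rs_lt_inv r1 r2 : p < r1 -> p < r2 -> rs r1 < rs r2 -> r1 < r2.
Proof.
  intros H1 H2 H; apply Rnot_le_lt; intros Hle.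
  destruct Hle as [Hlt | ->]; [|lra].
  specialize (Hrs_incr r2 r1 H2 Hlt); lra.
Qed.

(** * Boundedness of a mode and of its derivative *)

Variables (u u1 u2 : R -> Cx).
Hypotheses
  (Hu1 : forall s, derivC u s (u1 s)) (Hu2 : forall s, derivC u1 s (u2 s))
  (Hode : forall r, p < r ->
      Cadd (u2 (rs r)) (Cmul (Csub (Cmul w w) (Vpot M a w m lam r)) (u (rs r))) = C0).

(** Near the horizon [|(r - p)^xi| <= 1], because [Re xi = 2 M p Im w / (p - q)] is positive. Far
    out [|exp (i w rs)| <= 1] once [rs] is positive. Continuity covers the compact interval in
    between. *)
Lemma mode_bounded
  (Hbc_hor : exists g : R -> Cx, smooth1C g /\
      forall r, p < r ->
        g r = Cmul (Cpow_real (r - p) (Copp (xi M a w m))) (u (rs r)))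
  (Hbc_inf : exists Cs : nat -> Cx, forall N : nat, (1 <= N)%nat ->
      exists K R0, forall r, R0 < r ->
        Cnorm (Csub (u (rs r))
                 (Cmul (Cexp (Cmul Ci (Cscale (rs r) w)))
                       (Csum (fun i => Cscale (/ r ^ i) (Cs i)) N)))
        <= K * / r ^ (N + 1)) :
  exists B, forall s, norm1 (u s) <= B.
Proof.
  pose proof rplus_bounds as Hp.
  assert (Hleft : exists s0 B, forall s, s < s0 -> norm1 (u s) <= B).
  { destruct Hbc_hor as (g & [(D1 & E1 & Dg1) (D2 & E2 & Dg2)] & Hg).
    assert (Cg : forall (f : R -> R) D, D 0%nat = f ->
      (forall n x, derivable_pt_lim (D n) x (D (S n) x)) ->
      exists del, 0 < del /\ forall r, Rabs (r - p) <= del -> Rabs (f r - f p) < 1).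
    { intros f D <- Hf; apply cont_near; [|lra].
      apply (ex_derive_continuous (V := R_NormedModule)); eexists; apply is_derive_Reals, Hf. }
    destruct (Cg _ _ E1 Dg1) as (d1 & Hd1 & B1); destruct (Cg _ _ E2 Dg2) as (d2 & Hd2 & B2).
    (* The entry 1 makes [ln (r - p)] negative; the other two keep [g] within 1 of its value at [p]
       in each component. *)
    set (e := Rmin 1 (Rmin d1 d2)).
    assert (He : 0 < e) by (repeat apply Rmin_pos; lra).
    assert (He1 : e <= 1) by apply Rmin_l.
    assert (He2 : e <= d1) by (eapply Rle_trans; [apply Rmin_r | apply Rmin_l]).
    assert (He3 : e <= d2) by (eapply Rle_trans; [apply Rmin_r | apply Rmin_r]).
    exists (rs (p + e)), (2 * (norm1 (g p) + 2)); intros s Hs.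
    destruct (Hrs_onto s) as (r & Hr & <-).
    apply rs_lt_inv in Hs; [|exact Hr | lra].
    assert (Hgb : norm1 (g r) <= norm1 (g p) + 2).
    { specialize (B1 r ltac:(apply Rabs_le; lra)); specialize (B2 r ltac:(apply Rabs_le; lra)).
      pose proof (Rabs_triang_inv (Re (g r)) (Re (g p))).
      pose proof (Rabs_triang_inv (Im (g r)) (Im (g p))). unfold norm1; lra. }
    replace (u (rs r)) with (Cmul (Cpow_real (r - p) (xi M a w m)) (g r)).
    - apply norm1_mul_le; [|exact Hgb].
      eapply Rle_trans; [apply norm1_exp|].
      enough (exp (Re (Cscale (ln (r - p)) (xi M a w m))) <= 1) by lra.
      apply Rle_trans with (exp 0); [|rewrite exp_0; lra].
      left; apply exp_increasing.
      assert (ln (r - p) < 0) by (rewrite <- ln_1; apply ln_increasing; lra).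
      unfold xi; simpl.
      replace (ln (r - p) * (/ (p - q) * (0 * (a * IZR m + - (2 * M * p * Re w))
                 - 1 * (0 + - (2 * M * p * Im w)))))
        with (ln (r - p) * (/ (p - q) * (2 * M * p * Im w))) by ring.
      assert (0 < / (p - q) * (2 * M * p * Im w)).
      { apply Rmult_lt_0_compat; [apply Rinv_0_lt_compat, rplus_minus_pos|].
        repeat apply Rmult_lt_0_compat; lra. }
      nra.
    - rewrite Hg by exact Hr. unfold Cpow_real.
      assert (Hinv : forall z v, Cmul (Cexp z) (Cmul (Cexp (Copp z)) v) = v).
      { intros z v.
        pose proof (sin2_cos2 (Im z)) as Hsc; unfold Rsqr in Hsc.
        assert (Hee : exp (Re z) * exp (- Re z) = 1)
          by (rewrite <- exp_plus, <- exp_0; f_equal; ring).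
        apply Cx_eq; simpl; rewrite cos_neg, sin_neg.
        - transitivity (exp (Re z) * exp (- Re z)
              * (sin (Im z) * sin (Im z) + cos (Im z) * cos (Im z)) * Re v); [ring|].
          rewrite Hee, Hsc; ring.
        - transitivity (exp (Re z) * exp (- Re z)
              * (sin (Im z) * sin (Im z) + cos (Im z) * cos (Im z)) * Im v); [ring|].
          rewrite Hee, Hsc; ring. }
      replace (Cscale (ln (r - p)) (Copp (xi M a w m)))
        with (Copp (Cscale (ln (r - p)) (xi M a w m))) by (apply Cx_eq; simpl; ring).
      apply Hinv. }
  assert (Hright : exists s1 B, forall s, s1 < s -> norm1 (u s) <= B).
  (* The expansion to order one already gives a bound. *)
  { destruct Hbc_inf as (Cs & H); destruct (H 1%nat (le_n 1)) as (K & R0 & HK); clear H.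
    set (r1 := Rmax (Rmax R0 (2 * M)) (Rmax 1 (p + 1))).
    assert (Hr1 : R0 <= r1 /\ 1 <= r1 /\ p < r1).
    { unfold r1; pose proof (Rmax_l (Rmax R0 (2 * M)) (Rmax 1 (p + 1))).
      pose proof (Rmax_r (Rmax R0 (2 * M)) (Rmax 1 (p + 1))).
      pose proof (Rmax_l R0 (2 * M)); pose proof (Rmax_l 1 (p + 1)).
      pose proof (Rmax_r 1 (p + 1)). lra. }
    (* The 0 makes [rs r] positive, so that the exponential factor decays. *)
    exists (Rmax 0 (rs r1)), (2 * (norm1 (Cs 0%nat) + norm1 (Cs 1%nat)) + 2 * Rabs K).
    intros s Hs.
    pose proof (Rmax_l 0 (rs r1)); pose proof (Rmax_r 0 (rs r1)).
    destruct (Hrs_onto s) as (r & Hr & Es).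
    assert (Hr1r : r1 < r) by (apply rs_lt_inv; [lra | exact Hr | lra]).
    specialize (HK r ltac:(lra)).
    set (Y := Cmul _ (Csum _ _)) in HK.
    assert (HY : norm1 Y <= 2 * (norm1 (Cs 0%nat) + norm1 (Cs 1%nat))).
    { apply norm1_mul_le.
      - eapply Rle_trans; [apply norm1_exp|].
        enough (exp (Re (Cmul Ci (Cscale (rs r) w))) <= 1) by lra.
        apply Rle_trans with (exp 0); [|rewrite exp_0; lra].
        left; apply exp_increasing; simpl.
        assert (0 < rs r * Im w) by (apply Rmult_lt_0_compat; lra). lra.
      - cbn [Csum]. eapply Rle_trans; [apply norm1_add|].
        assert (Hi : 0 < / r <= 1).
        { split; [apply Rinv_0_lt_compat; lra|].
          rewrite <- Rinv_1; apply Rinv_le_contravar; lra. }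
        rewrite !norm1_scale; simpl. rewrite Rmult_1_r, Rinv_1, Rabs_R1, Rabs_pos_eq by lra.
        pose proof (norm1_ge0 (Cs 1%nat)). nra. }
    assert (HK' : norm1 (Csub (u (rs r)) Y) <= 2 * Rabs K).
    { eapply Rle_trans; [apply norm1_le_Cnorm|].
      apply Rmult_le_compat_l; [lra|].
      eapply Rle_trans; [exact HK|].
      assert (Hi : 0 < / r ^ (1 + 1) <= 1).
      { assert (1 <= r ^ (1 + 1)) by (simpl; nra).
        split; [apply Rinv_0_lt_compat; lra|].
        rewrite <- Rinv_1; apply Rinv_le_contravar; lra. }
      pose proof (Rle_abs K). pose proof (Rabs_pos K). nra. }
    rewrite <- Es.
    replace (u (rs r)) with (Cadd Y (Csub (u (rs r)) Y)) by (apply Cx_eq; simpl; ring).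
    eapply Rle_trans; [apply norm1_add | lra]. }
  destruct Hleft as (s0 & B0 & H0); destruct Hright as (s1 & B1 & H1).
  assert (Hmid : exists B, forall s, s0 <= s <= s1 -> norm1 (u s) <= B).
  { destruct (bounded_continuity (K := R_AbsRing) (V := R_NormedModule)
                (fun s => Re (u s)) s0 s1) as [A1 HA1].
    { intros x _; apply (ex_derive_continuous (V := R_NormedModule) (fun s => Re (u s))).
      eexists; apply is_derive_Reals, (Hu1 x). }
    destruct (bounded_continuity (K := R_AbsRing) (V := R_NormedModule)
                (fun s => Im (u s)) s0 s1) as [A2 HA2].
    { intros x _; apply (ex_derive_continuous (V := R_NormedModule) (fun s => Im (u s))).
      eexists; apply is_derive_Reals, (Hu1 x). }
    exists (A1 + A2); intros s Hs.
    specialize (HA1 s Hs); specialize (HA2 s Hs).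
    unfold norm, abs in HA1, HA2; simpl in HA1, HA2.
    unfold norm1; unfold abs in *; simpl in *; lra. }
  destruct Hmid as (B2 & H2).
  exists (Rmax B0 (Rmax B1 B2)); intros s.
  pose proof (Rmax_l B0 (Rmax B1 B2)); pose proof (Rmax_r B0 (Rmax B1 B2)).
  pose proof (Rmax_l B1 B2); pose proof (Rmax_r B1 B2).
  destruct (Rlt_or_le s s0) as [Hs | Hs]; [specialize (H0 s Hs); lra|].
  destruct (Rlt_or_le s1 s) as [Hs' | Hs']; [specialize (H1 s Hs'); lra|].
  specialize (H2 s (conj Hs Hs')); lra.
Qed.

Lemma mode_derivative_bounded B : (forall s, norm1 (u s) <= B) ->
  exists B', forall s, norm1 (u1 s) <= B'.
Proof.
  intros HB; destruct Vpot_bounded as [BV HV].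
  exists (4 * B + 2 * (BV * B)); intros s.
  apply (bounded_derivative u u1 u2); auto.
  clear s; intros s; destruct (Hrs_onto s) as (r & Hr & <-).
  specialize (Hode r Hr).
  set (X := Cmul _ _) in Hode.
  assert (E : u2 (rs r) = Copp X).
  { assert (H1 := f_equal Re Hode); assert (H2 := f_equal Im Hode).
    apply Cx_eq; simpl in *; lra. }
  rewrite E, norm1_opp. apply norm1_mul_le; auto.
Qed.

(** * Reduction to polynomial coefficients *)

Notation am := (a * IZR m).
Notation vp r := (r ^ 2 + a ^ 2).

Definition Lam_sep : Cx :=
  Csub (Cadd lam (Cscale (a ^ 2) (Cmul w w))) (Cscale (2 * am) w).

Definition Kfun (r : R) : Cx := Csub (Cscale (vp r) w) (RtoC am).

Definition sigma (r : R) : R := / sqrt (vp r).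

Definition Rfun (r : R) : Cx := Cscale (sigma r) (u (rs r)).

(* [Delta] times the derivative of [Rfun]. *)
Definition DRfun (r : R) : Cx :=
  Csub (Cscale (sigma r * vp r) (u1 (rs r))) (Cscale (r * Del r * sigma r / vp r) (u (rs r))).

(* [exp (- i \int K / Delta)]. *)
Definition Zfun (r : R) : Cx :=
  Cexp (Cadd (Cscale (- rs r) (Cmul Ci w))
             (Cscale (am / (p - q) * (ln (r - p) - ln (r - q))) Ci)).

Definition gfun (r : R) : Cx := Cmul (Zfun r) (Rfun r).
Definition kfun (r : R) : Cx := Cmul (Zfun r) (Csub (DRfun r) (Cmul Ci (Cmul (Kfun r) (Rfun r)))).

Lemma vp_pos r : p < r -> 0 < vp r.
Proof. intros; pose proof rplus_bounds; nra. Qed.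

Lemma sigma_deriv r : p < r -> is_derive sigma r (- (r * sigma r / vp r)).
Proof.
  intros Hr; pose proof (vp_pos r Hr) as Hv; pose proof (sqrt_lt_R0 _ Hv) as Hs.
  unfold sigma; auto_derive.
  - split; [replace (r * (r * 1) + a * (a * 1)) with (vp r) by ring; exact Hv|].
    split; [|exact I].
    replace (r * (r * 1) + a * (a * 1)) with (vp r) by ring; lra.
  - replace (r * (r * 1) + a * (a * 1)) with (vp r) by ring.
    set (s := sqrt (vp r)) in *.
    replace (vp r) with (s * s) by (apply sqrt_sqrt; lra). field; lra.
Qed.

Lemma Rfun_deriv r : p < r -> derivC Rfun r (Cscale (/ Del r) (DRfun r)).
Proof.
  intros Hr; pose proof (vp_pos r Hr) as Hv; pose proof (DeltaK_pos r Hr) as HD.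
  eapply derivC_eq.
  - apply derivC_scale; [apply is_derive_Reals, sigma_deriv, Hr|].
    apply (derivC_comp rs u); [apply Hrs_deriv, Hr | apply Hu1].
  - unfold DRfun; apply Cx_eq; cbn [Re Im Cadd Csub Copp Cscale]; field; lra.
Qed.

(** This is [(Delta R')' = (L - K^2 / Delta) R]. The part of [V] free of [w], [m] and [lambda] is
    exactly what the factor [(r^2 + a^2)^(-1/2)] produces, and it cancels. *)
Lemma DRfun_deriv r : p < r ->
  derivC DRfun r (Csub (Cmul Lam_sep (Rfun r))
                       (Cscale (/ Del r) (Cmul (Kfun r) (Cmul (Kfun r) (Rfun r))))).
Proof.
  intros Hr; pose proof (vp_pos r Hr) as Hv; pose proof (DeltaK_pos r Hr) as HD.
  pose proof (sigma_deriv r Hr) as Hs.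
  eapply derivC_eq.
  - apply derivC_add; [|apply derivC_opp].
    + apply (derivC_scale (fun r => sigma r * vp r)).
      * apply is_derive_Reals. auto_derive; [eexists; exact Hs | reflexivity].
      * apply (derivC_comp rs u1); [apply Hrs_deriv, Hr | apply Hu2].
    + apply (derivC_scale (fun r => r * Del r * sigma r / vp r)).
      * apply is_derive_Reals. unfold DeltaK. auto_derive; [|reflexivity].
        split; [eexists; exact Hs | split; [|exact I]].
        replace (r * (r * 1) + a * (a * 1)) with (vp r) by ring; lra.
      * apply (derivC_comp rs u); [apply Hrs_deriv, Hr | apply Hu1].
  - change (fun x => sigma x) with sigma.
    rewrite (is_derive_unique sigma r _ Hs).
    specialize (Hode r Hr).
    assert (E : u2 (rs r) = Copp (Cmul (Csub (Cmul w w) (Vpot M a w m lam r)) (u (rs r)))).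
    { set (X := Cmul _ _) in Hode |- *.
      assert (H1 := f_equal Re Hode); assert (H2 := f_equal Im Hode).
      apply Cx_eq; simpl in *; lra. }
    rewrite E; unfold Vpot, Lam_sep, Kfun, Rfun; cbv zeta.
    generalize (u (rs r)), (u1 (rs r)), (sigma r), (IZR m); intros U U1 s mm.
    unfold DeltaK in *. clear - Hv HD.
    apply Cx_eq; cbn [Re Im Cadd Csub Copp Cscale Cmul RtoC]; field; lra.
Qed.

(** [K / Delta] is [w] times the slope of [rs] minus [a m / Delta]; partial fractions of [1 / Delta]
    account for the two logarithms. *)
Lemma Zfun_deriv r : p < r ->
  derivC Zfun r (Cscale (- / Del r) (Cmul Ci (Cmul (Kfun r) (Zfun r)))).
Proof.
  intros Hr; pose proof (DeltaK_pos r Hr) as HD; pose proof rplus_minus_pos as Hpq.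
  eapply derivC_eq.
  - apply derivC_exp, derivC_add.
    + apply (derivC_scale (fun r => - rs r)); [|apply derivC_const].
      apply derivable_pt_lim_opp, Hrs_deriv, Hr.
    + apply (derivC_scale (fun r => am / (p - q) * (ln (r - p) - ln (r - q))));
        [|apply derivC_const].
      apply is_derive_Reals; auto_derive; [|reflexivity]. repeat split; lra.
  - cbv beta; fold (Zfun r); generalize (Zfun r); intros Z.
    unfold Kfun; rewrite (DeltaK_factor r).
    apply Cx_eq; cbn [Re Im Cadd Csub Copp Cscale Cmul RtoC Ci C0]; field; lra.
Qed.

Lemma gfun_deriv r : p < r -> derivC gfun r (Cscale (/ Del r) (kfun r)).
Proof.
  intros Hr; pose proof (DeltaK_pos r Hr) as HD.
  eapply derivC_eq.
  - apply derivC_mul; [now apply Zfun_deriv | now apply Rfun_deriv].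
  - unfold kfun. generalize (Zfun r), (Kfun r), (DRfun r), (Rfun r); intros.
    apply Cx_eq; cbn [Re Im Cadd Csub Copp Cscale Cmul Ci]; field; lra.
Qed.

(** Since [kfun] is [Delta g'], this is the equation for [g]. Differentiating the phase twice
    creates a second [K^2 / Delta], of opposite sign to the one in [DRfun_deriv]. *)
Lemma kfun_deriv r : p < r ->
  derivC kfun r
    (Csub (Cscale (- 2 / Del r) (Cmul Ci (Cmul (Kfun r) (kfun r))))
          (Cmul (Csub (Cscale (2 * r) (Cmul Ci w)) Lam_sep) (gfun r))).
Proof.
  intros Hr; pose proof (DeltaK_pos r Hr) as HD.
  eapply derivC_eq.
  - apply derivC_mul; [now apply Zfun_deriv|].
    apply derivC_add; [now apply DRfun_deriv | apply derivC_opp].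
    apply derivC_mul; [apply derivC_const|].
    apply derivC_mul; [|now apply Rfun_deriv].
    apply derivC_add; [|apply derivC_opp, derivC_const].
    apply (derivC_scale (fun r => vp r)); [|apply derivC_const].
    apply is_derive_Reals; auto_derive; [exact I | reflexivity].
  - unfold kfun, gfun. fold (Kfun r).
    generalize (Zfun r), (Kfun r), (DRfun r), (Rfun r), Lam_sep; intros.
    apply Cx_eq; cbn [Re Im Cadd Csub Copp Cscale Cmul Ci C0]; field; lra.
Qed.

(** * Growth bounds and extension across the horizon *)

Lemma Zfun_norm r : norm1 (Zfun r) <= 2 * exp (Im w * rs r).
Proof.
  eapply Rle_trans; [apply norm1_exp|]. right; f_equal; f_equal; simpl; ring.
Qed.

Lemma sigma_bounds r : p < r -> 0 < sigma r /\ sigma r <= / M /\ sigma r * r <= 1.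
Proof.
  intros Hr; pose proof rplus_bounds as Hp; pose proof (vp_pos r Hr) as Hv.
  assert (Hs : r <= sqrt (vp r)).
  { rewrite <- (sqrt_pow2 r) at 1 by lra. apply sqrt_le_1_alt; nra. }
  unfold sigma; repeat split.
  - apply Rinv_0_lt_compat; lra.
  - apply Rinv_le_contravar; lra.
  - apply (Rmult_le_reg_l (sqrt (vp r))); [lra|].
    rewrite <- Rmult_assoc, Rinv_r by lra. lra.
Qed.

(** The exponential is the size of [Zfun]; the quadratic factor comes from [Kfun] and from
    [sigma r * vp r] in [DRfun]. *)
Lemma gfun_kfun_bound B : (forall s, norm1 (u s) <= B) -> (forall s, norm1 (u1 s) <= B) ->
  exists C, 0 <= C /\ forall r, p < r ->
    norm1 (gfun r) <= C * (1 + vp r) * exp (Im w * rs r) /\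
    norm1 (kfun r) <= C * (1 + vp r) * exp (Im w * rs r).
Proof.
  intros HB HB1.
  assert (HB0 : 0 <= B) by (specialize (HB 0); pose proof (norm1_ge0 (u 0)); lra).
  set (c := norm1 w + Rabs am).
  assert (Hc : 0 <= c) by (pose proof (norm1_ge0 w); pose proof (Rabs_pos am); unfold c; lra).
  assert (HiM : 0 < / M) by now apply Rinv_0_lt_compat.
  exists (2 * (/ M * B + B + 2 * (c * (/ M * B)))).
  assert (H0 : 0 <= / M * B) by (apply Rmult_le_pos; lra).
  assert (H1 : 0 <= c * (/ M * B)) by now apply Rmult_le_pos.
  split; [lra|]; intros r Hr.
  pose proof (vp_pos r Hr) as Hv; pose proof (DeltaK_pos r Hr) as HD.
  pose proof rplus_bounds as Hp.
  destruct (sigma_bounds r Hr) as (S1 & S2 & S3).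
  pose proof (exp_pos (Im w * rs r)) as He.
  assert (NR : norm1 (Rfun r) <= / M * B).
  { unfold Rfun; rewrite norm1_scale, Rabs_pos_eq by lra.
    apply Rmult_le_compat; auto using norm1_ge0; lra. }
  assert (NK : norm1 (Kfun r) <= c * (1 + vp r)).
  { unfold Kfun; eapply Rle_trans; [apply norm1_sub|].
    rewrite norm1_scale, norm1_RtoC, (Rabs_pos_eq (vp r)) by lra.
    pose proof (norm1_ge0 w); pose proof (Rabs_pos am).
    assert (0 <= Rabs am * vp r) by (apply Rmult_le_pos; lra). unfold c; lra. }
  assert (ND : norm1 (DRfun r) <= (/ M * B + B) * (1 + vp r)).
  { unfold DRfun; eapply Rle_trans; [apply norm1_sub|].
    rewrite !norm1_scale.
    assert (Hq : 0 <= r * Del r * sigma r / vp r <= 1).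
    { split.
      - apply Rdiv_le_0_compat; [|exact Hv]. repeat apply Rmult_le_pos; lra.
      - apply (Rmult_le_reg_r (vp r)); [lra|].
        unfold Rdiv; rewrite Rmult_assoc, Rinv_l, Rmult_1_r, Rmult_1_l by lra.
        replace (r * Del r * sigma r) with (Del r * (sigma r * r)) by ring.
        rewrite <- (Rmult_1_r (vp r)). apply Rmult_le_compat; try lra.
        + apply Rmult_le_pos; lra.
        + unfold DeltaK; nra. }
    rewrite (Rabs_pos_eq (r * Del r * sigma r / vp r)) by lra.
    rewrite Rabs_pos_eq by (apply Rmult_le_pos; lra).
    assert (A1 : sigma r * vp r * norm1 (u1 (rs r)) <= / M * vp r * B).
    { apply Rmult_le_compat; auto using norm1_ge0.
      - apply Rmult_le_pos; lra.
      - apply Rmult_le_compat_r; lra. }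
    assert (A2 : r * Del r * sigma r / vp r * norm1 (u (rs r)) <= 1 * B).
    { apply Rmult_le_compat; auto using norm1_ge0; lra. }
    assert (0 <= B * vp r) by (apply Rmult_le_pos; lra). lra. }
  pose proof (Zfun_norm r) as NZ.
  split.
  - pose proof (norm1_mul_le _ _ _ _ NZ NR) as N.
    assert (0 <= (/ M * B) * vp r) by (apply Rmult_le_pos; lra).
    eapply Rle_trans; [exact N|].
    replace (2 * exp (Im w * rs r) * (/ M * B)) with (2 * (/ M * B) * exp (Im w * rs r)) by ring.
    apply Rmult_le_compat_r; [lra|].
    assert (0 <= (B + 2 * (c * (/ M * B))) * (1 + vp r)) by (apply Rmult_le_pos; lra). lra.
  - assert (NN : norm1 (Csub (DRfun r) (Cmul Ci (Cmul (Kfun r) (Rfun r))))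
       <= (/ M * B + B + 2 * (c * (/ M * B))) * (1 + vp r)).
    { eapply Rle_trans; [apply norm1_sub|].
      assert (N2 : norm1 (Cmul Ci (Cmul (Kfun r) (Rfun r)))
                   <= 2 * (c * (1 + vp r) * (/ M * B))).
      { apply norm1_mul_le; [unfold norm1; simpl; rewrite Rabs_R0, Rabs_R1; lra|].
        now apply norm1_mul_le. }
      lra. }
    pose proof (norm1_mul_le _ _ _ _ NZ NN) as N.
    eapply Rle_trans; [exact N | right; ring].
Qed.

(** The shift moves the inner horizon to [t = 0]. Extension by zero lets transforms be taken over
    the fixed half-line [t >= 0], although the solution lives only on [t > p - q]. *)
Definition extend_zero (f : R -> Cx) (t : R) : Cx :=
  if Rle_dec t (p - q) then C0 else f (t + q).

Lemma extend_zero_left f t : t <= p - q -> extend_zero f t = C0.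
Proof. intros; unfold extend_zero; destruct (Rle_dec t (p - q)); [reflexivity | lra]. Qed.

Lemma extend_zero_right f t : p - q < t -> extend_zero f t = f (t + q).
Proof. intros; unfold extend_zero; destruct (Rle_dec t (p - q)); [lra | reflexivity]. Qed.

Lemma extend_zero_deriv f f' t : (forall r, p < r -> derivC f r (f' r)) ->
  p - q < t -> derivC (extend_zero f) t (f' (t + q)).
Proof.
  intros Hf Ht.
  assert (Hloc : locally t (fun x => f (x + q) = extend_zero f x)).
  { apply (filter_imp (fun x => p - q < x)); [|apply (open_gt (p - q)); exact Ht].
    intros x Hx; now rewrite extend_zero_right. }
  assert (HD : derivC (fun x => f (x + q)) t (f' (t + q))).
  { eapply derivC_eq.
    - apply (derivC_comp (fun x => x + q) f); [|apply Hf; lra].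
      apply is_derive_Reals; auto_derive; [exact I | reflexivity].
    - apply Cx_eq; simpl; ring. }
  destruct HD as [H1 H2]; apply is_derive_Reals in H1; apply is_derive_Reals in H2.
  split; apply is_derive_Reals.
  - eapply is_derive_ext_loc; [|exact H1].
    apply (filter_imp _ _ (fun x Hx => f_equal Re Hx) Hloc).
  - eapply is_derive_ext_loc; [|exact H2].
    apply (filter_imp _ _ (fun x Hx => f_equal Im Hx) Hloc).
Qed.

(** At the horizon [rs] tends to minus infinity, so [exp (Im w rs)] tends to zero. Surjectivity of
    [rs] provides the radius below which this factor is as small as required. *)
Lemma extend_zero_continuous f f' C :
  (forall r, p < r -> derivC f r (f' r)) -> 0 <= C ->
  (forall r, p < r -> norm1 (f r) <= C * (1 + vp r) * exp (Im w * rs r)) ->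
  continuousC (extend_zero f).
Proof.
  intros Hf HC Hb.
  apply (continuousC_vanishing_left _ (fun t => f' (t + q)) (p - q)).
  - apply extend_zero_left.
  - intros t Ht; now apply extend_zero_deriv.
  - intros eps He.
    pose proof rplus_bounds as Hp; pose proof rminus_nonneg as Hq.
    set (V := C * (1 + vp (p + 1)) + 1).
    assert (Hv : 0 <= C * (1 + vp (p + 1))).
    { apply Rmult_le_pos; [exact HC|].
      pose proof (vp_pos (p + 1) ltac:(lra)); lra. }
    assert (HV : 0 < eps / V) by (apply Rdiv_lt_0_compat; unfold V; lra).
    destruct (Hrs_onto (ln (eps / V) / Im w)) as (r0 & Hr0 & Er0).
    exists (Rmin (r0 - q) (p + 1 - q)).
    split; [apply Rmin_glb_lt; lra|].
    intros t Ht.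
    pose proof (Rmin_l (r0 - q) (p + 1 - q)); pose proof (Rmin_r (r0 - q) (p + 1 - q)).
    rewrite extend_zero_right by lra.
    eapply Rle_lt_trans; [apply Hb; lra|].
    assert (Hexp : exp (Im w * rs (t + q)) < eps / V).
    { rewrite <- (exp_ln (eps / V)) by exact HV. apply exp_increasing.
      replace (ln (eps / V)) with (Im w * rs r0) by (rewrite Er0; field; lra).
      apply Rmult_lt_compat_l; [lra|]. apply Hrs_incr; lra. }
    assert (Hvle : C * (1 + vp (t + q)) <= V).
    { assert (C * (1 + vp (t + q)) <= C * (1 + vp (p + 1))); [|unfold V; lra].
      apply Rmult_le_compat_l; [exact HC|]. nra. }
    pose proof (exp_pos (Im w * rs (t + q))).
    apply Rle_lt_trans with (V * exp (Im w * rs (t + q))).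
    + apply Rmult_le_compat_r; lra.
    + replace eps with (V * (eps / V)) by (field; unfold V; lra).
      apply Rmult_lt_compat_l; [unfold V; lra | exact Hexp].
Qed.

Lemma exp_growth : exists A, 0 <= A /\ forall t, p - q < t ->
  (1 + vp (t + q)) * exp (Im w * rs (t + q)) <= A * exp (7 / 4 * Im w * t).
Proof.
  destruct rs_growth as [A0 HA0].
  pose proof rplus_minus_pos as Hd; pose proof rminus_nonneg as Hq.
  (* The quadratic factor costs [Im w / 4] and [rs_growth] costs [3 / 2 * Im w], in total
     [7 / 4 * Im w]. *)
  set (e := Im w / 4). assert (He : 0 < e) by (unfold e; lra).
  set (c1 := INR (fact 1) / e ^ 1). set (c2 := INR (fact 2) / e ^ 2).
  assert (Hc1 : 0 < c1) by (apply Rdiv_lt_0_compat; [apply INR_fact_lt_0 | now apply pow_lt]).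
  assert (Hc2 : 0 < c2) by (apply Rdiv_lt_0_compat; [apply INR_fact_lt_0 | now apply pow_lt]).
  set (P := 1 + q ^ 2 + a ^ 2 + 2 * q * c1 + c2).
  assert (Hqc : 0 <= q * c1) by (apply Rmult_le_pos; lra).
  assert (HP : 0 <= P).
  { pose proof (pow2_ge_0 q); pose proof (pow2_ge_0 a); unfold P; lra. }
  exists (P * exp (Im w * (A0 + 3 / 2 * q))).
  split; [apply Rmult_le_pos; [exact HP | left; apply exp_pos]|].
  intros t Ht.
  assert (H1 := pow_le_exp 1 e t He ltac:(lra)); fold c1 in H1.
  assert (H2 := pow_le_exp 2 e t He ltac:(lra)); fold c2 in H2.
  assert (H3 : 1 <= exp (e * t)).
  { pose proof (exp_ineq1_le (e * t)). assert (0 < e * t) by (apply Rmult_lt_0_compat; lra). lra. }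
  set (E := exp (e * t)) in *.
  assert (HPt : 1 + vp (t + q) <= P * E).
  { replace (1 + vp (t + q)) with (1 + q ^ 2 + a ^ 2 + 2 * q * t ^ 1 + t ^ 2) by ring.
    pose proof (pow2_ge_0 q); pose proof (pow2_ge_0 a).
    assert ((1 + q ^ 2 + a ^ 2) * 1 <= (1 + q ^ 2 + a ^ 2) * E) by (apply Rmult_le_compat_l; lra).
    assert (2 * q * t ^ 1 <= 2 * q * (c1 * E)) by (apply Rmult_le_compat_l; lra).
    unfold P; lra. }
  assert (HR : exp (Im w * rs (t + q))
               <= exp (Im w * (A0 + 3 / 2 * q)) * exp (3 / 2 * Im w * t)).
  { rewrite <- exp_plus.
    assert (Hle : Im w * rs (t + q) <= Im w * (A0 + 3 / 2 * q) + 3 / 2 * Im w * t).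
    { specialize (HA0 (t + q) ltac:(lra)).
      apply (Rmult_le_compat_l (Im w)) in HA0; lra. }
    destruct Hle as [Hl | ->]; [left; now apply exp_increasing | lra]. }
  replace (7 / 4 * Im w * t) with (e * t + 3 / 2 * Im w * t) by (unfold e; field).
  rewrite exp_plus; fold E.
  replace (P * exp (Im w * (A0 + 3 / 2 * q)) * (E * exp (3 / 2 * Im w * t)))
    with (P * E * (exp (Im w * (A0 + 3 / 2 * q)) * exp (3 / 2 * Im w * t))) by ring.
  apply Rmult_le_compat; auto.
  - pose proof (vp_pos (t + q) ltac:(lra)); lra.
  - left; apply exp_pos.
Qed.

Lemma bounded_mode_zero B :
  Re w * Im lam - Im w * Re lam <= 0 ->
  (forall s, norm1 (u s) <= B) -> (forall s, norm1 (u1 s) <= B) ->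
  forall s, u s = C0.
Proof.
  intros Hang HB HB1.
  pose proof rplus_minus_pos as Hd; pose proof rminus_nonneg as Hq.
  pose proof rplus_mul_rminus as Hpq.
  assert (Haa : q * (q + (p - q)) = a ^ 2) by (rewrite <- Hpq; ring).
  destruct (gfun_kfun_bound B HB HB1) as (C & HC & HCb).
  destruct exp_growth as (A & HA & HAb).
  assert (Hgrow : forall f, (forall r, p < r ->
        norm1 (f r) <= C * (1 + vp r) * exp (Im w * rs r)) ->
      forall t, p - q < t -> norm1 (extend_zero f t) <= C * A * exp (7 / 4 * Im w * t)).
  { intros f Hf t Ht; rewrite extend_zero_right by exact Ht.
    eapply Rle_trans; [apply Hf; lra|].
    rewrite (Rmult_assoc C), (Rmult_assoc C A).
    apply Rmult_le_compat_l; [exact HC | now apply HAb]. }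
  assert (HKp : forall t, Kpot (p - q) q am w t = Kfun (t + q)).
  { intros t; unfold Kpot, Kfun; now rewrite Haa. }
  assert (HDl : forall t, t * (t - (p - q)) = Del (t + q)).
  { intros t; rewrite DeltaK_factor; ring. }
  assert (Hz : forall t, p - q < t -> extend_zero gfun t = C0).
  { apply (bounded_growth_solution_zero (p - q) q am w Lam_sep Hd Hq Hw) with
      (k := extend_zero kfun) (C := C * A).
    (* In [Im (conj w L)] the term [2 a m w] contributes a real multiple of [|w|^2] and drops out;
       [a^2 w^2] gives [a^2 |w|^2 Im w], precisely the allowance in the hypothesis. *)
    - rewrite Haa. unfold Lam_sep; simpl.
      replace (Re w * (Im lam + a * (a * 1) * (Re w * Im w + Im w * Re w)
                 + - (2 * (a * IZR m) * Im w))
               - Im w * (Re lam + a * (a * 1) * (Re w * Re w - Im w * Im w)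
                 + - (2 * (a * IZR m) * Re w)))
        with ((Re w * Im lam - Im w * Re lam)
              + a ^ 2 * (Re w ^ 2 + Im w ^ 2) * Im w) by ring.
      simpl in *; lra.
    - apply extend_zero_left.
    - apply extend_zero_left.
    - apply (extend_zero_continuous _ _ C gfun_deriv HC); intros r Hr; now apply HCb.
    - apply (extend_zero_continuous _ _ C kfun_deriv HC); intros r Hr; now apply HCb.
    - apply Hgrow; intros r Hr; now apply HCb.
    - apply Hgrow; intros r Hr; now apply HCb.
    - intros t Ht; rewrite HDl, (extend_zero_right kfun) by exact Ht.
      apply (extend_zero_deriv gfun (fun r => Cscale (/ Del r) (kfun r)) t gfun_deriv Ht).
    - intros t Ht; rewrite HDl, HKp, !extend_zero_right by exact Ht.
      exact (extend_zero_deriv kfun _ t kfun_deriv Ht). }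
  intros s; destruct (Hrs_onto s) as (r & Hr & <-).
  specialize (Hz (r - q) ltac:(lra)).
  rewrite extend_zero_right in Hz by lra.
  replace (r - q + q) with r in Hz by ring.
  apply Cexp_mul_eq0 in Hz.
  destruct (sigma_bounds r Hr) as (S1 & _ & _).
  assert (H1 := f_equal Re Hz); assert (H2 := f_equal Im Hz); simpl in H1, H2.
  apply Cx_eq; simpl.
  - apply Rmult_integral in H1; destruct H1; [lra | assumption].
  - apply Rmult_integral in H2; destruct H2; [lra | assumption].
Qed.

End Kerr.

Theorem mainTheorem2
  (M a : R) (HM : 0 < M) (Ha : Rabs a < M)
  (* the tortoise coordinate r* : (r_+, oo) -> R, increasing bijection with
     dr*/dr = (r^2+a^2)/Delta *)
  (rs : R -> R)
  (Hrs_deriv : forall r, rplus M a < r ->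
      derivable_pt_lim rs r ((r ^ 2 + a ^ 2) / DeltaK M a r))
  (Hrs_incr : forall r1 r2, rplus M a < r1 -> r1 < r2 -> rs r1 < rs r2)
  (Hrs_onto : forall s, exists r, rplus M a < r /\ rs r = s)
  (w : Cx) (Hw : 0 < Im w) (m : Z) (lam : Cx)
  (Hlam : angular_eigenvalue a w m lam)
  (u u1 u2 : R -> Cx)
  (Hu1 : forall s, derivC u s (u1 s))
  (Hu2 : forall s, derivC u1 s (u2 s))
  (Hode : forall r, rplus M a < r ->
      Cadd (u2 (rs r)) (Cmul (Csub (Cmul w w) (Vpot M a w m lam r)) (u (rs r))) = C0)
  (Hbc_hor : exists g : R -> Cx, smooth1C g /\
      forall r, rplus M a < r ->
        g r = Cmul (Cpow_real (r - rplus M a) (Copp (xi M a w m))) (u (rs r)))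
  (Hbc_inf : exists Cs : nat -> Cx, forall N : nat, (1 <= N)%nat ->
      exists K R0, forall r, R0 < r ->
        Cnorm (Csub (u (rs r))
                 (Cmul (Cexp (Cmul Ci (Cscale (rs r) w)))
                       (Csum (fun i => Cscale (/ r ^ i) (Cs i)) N)))
        <= K * / r ^ (N + 1))
  : forall s, u s = C0.
Proof.
  pose proof (angular_eigenvalue_sign a w m lam Hw Hlam) as Hang.
  destruct (mode_bounded M a HM Ha w m Hw rs Hrs_incr Hrs_onto u u1 Hu1 Hbc_hor Hbc_inf)
    as [B HB].
  destruct (mode_derivative_bounded M a HM Ha w m lam rs Hrs_onto u u1 u2 Hu1 Hu2 Hode B HB)
    as [B' HB'].
  apply (bounded_mode_zero M a HM Ha w m lam Hw rs Hrs_deriv Hrs_incr Hrs_onto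
           u u1 u2 Hu1 Hu2 Hode (Rmax B B') Hang).
  - intros s; eapply Rle_trans; [apply HB | apply Rmax_l].
  - intros s; eapply Rle_trans; [apply HB' | apply Rmax_r].
Qed.
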